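(* For AVL trees, red-black trees and $\alpha$ weight-balanced trees, the join algorithm $\mathrm{join}(T_l,k,T_r)$ (for the respective scheme, as described in the context) does $O(|r(T_l)-r(T_r)|)$ work. For treaps, $\mathrm{join}(T_l,k,T_r)$ does $O(\log t)$ work in expectation if $k$ has the $t$-th highest priority among all keys of $T_l\cup\{k\}\cup T_r$. For all four schemes (AVL, RB, WB trees and treaps), $\mathrm{join}$ returns a tree $T$ whose rank satisfies $\max(r(T_l),r(T_r))\le r(T)\le 1+\max(r(T_l),r(T_r))$.
   Context: A binary tree is either the empty tree $\mathrm{Leaf}$ or a node $\mathrm{Node}(L,k,R)$; $L(T),k(T),R(T)$ denote the components of a nonempty $T$, $\mathrm{expose}(T)=(L(T),k(T),R(T))$. Size $|T|$, weight $w(T)=|T|+1$, height $h(T)$ ($0$ for Leaf, $1+\max(h(L),h(R))$ otherwise). $\mathrm{rotateLeft}(\mathrm{Node}(A,x,\mathrm{Node}(B,y,C)))=\mathrm{Node}(\mathrm{Node}(A,x,B),y,C)$ and $\mathrm{rotateRight}$ is its inverse. $\mathrm{join}(T_l,k,T_r)$ returns a tree whose in-order sequence is that of $T_l$, then $k$, then that of $T_r$. Balancing schemes and ranks. AVL: at each node the heights of the two children differ by at most one; $r(T)=h(T)-1$. Red-black (RB): each node red or black (leaves black), no red node has a red child, every downward path to a leaf has the same number of black nodes, root may be red; $\mathrm{bh}(T)$ is the number of black nodes on a downward path from the root to a leaf inclusive of the root; $r(T)=2(\mathrm{bh}(T)-1)$ if the root is black and $2\mathrm{bh}(T)-1$ if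 red. Weight-balanced (WB) with parameter $\alpha$, $\frac{2}{11}<\alpha\le 1-\frac{1}{\sqrt2}$: every $T=\mathrm{Node}(L,v,R)$ has $\alpha\le w(L)/w(T)\le1-\alpha$; $T_1,T_2$ have like weights if $\mathrm{Node}(T_1,v,T_2)$ satisfies this at the root; $r(T)=\lceil\log_2 w(T)\rceil-1$. Treap: keys carry independent uniformly random priorities, heap-ordered with the highest priority at the root; $r(T)=\lceil\log_2 w(T)\rceil-1$. Nodes store height/color and black height/weight/priority; expose, node creation, recoloring, rotations cost $O(1)$. Join algorithms. AVL: $\mathrm{joinRight}(T_l,k,T_r)$: let $(l,k',c)=\mathrm{expose}(T_l)$; if $h(c)\le h(T_r)+1$, let $T'=\mathrm{Node}(c,k,T_r)$ and return $\mathrm{Node}(l,k',T')$ if $h(T')\le h(l)+1$, else $\mathrm{rotateLeft}(\mathrm{Node}(l,k',\mathrm{rotateRight}(T')))$; otherwise $T'=\mathrm{joinRight}(c,k,T_r)$, $T''=\mathrm{Node}(l,k',T')$, return $T''$ if $h(T')\le h(l)+1$ else $\mathrm{rotateLeft}(T'')$; joinLeft is the mirror; join calls joinRight if $h(T_l)>h(T_r)+1$, joinLeft if $h(T_r)>h(T_l)+1$, else returns $\mathrm{Node}(T_l,k,T_r)$. RB: if $\mathrm{bh}(T_l)=\mathrm{bh}(T_r)$ return $\mathrm{Node}(T_l,k,T_r)$ with $k$ red if both roots are black and black otherwise; if $\mathrm{bh}(T_l)>\mathrm{bh}(T_r)$, walk down the right spine of $T_l$ to the first black node $c$ with $\mathrm{bh}(c)=\mathrm{bh}(T_r)$,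 replace it by the red node $\mathrm{Node}(c,k,T_r)$, then going back up, whenever a black node $v$ has $R(v),R(R(v))$ both red, color $R(R(v))$ black and rotate left at $v$; finally if the root is red with a red right child recolor the root black; the other case is the mirror. WB: $\mathrm{joinRightWB}(T_l,k,T_r)$: if $T_l,T_r$ have like weights return $\mathrm{Node}(T_l,k,T_r)$; else $(l,k',c)=\mathrm{expose}(T_l)$, $T'=\mathrm{joinRightWB}(c,k,T_r)$, $(l_1,k_1,r_1)=\mathrm{expose}(T')$; if $l,T'$ have like weights return $\mathrm{Node}(l,k',T')$; else if $l,l_1$ have like weights and $\mathrm{Node}(l,k',l_1),r_1$ have like weights return $\mathrm{rotateLeft}(\mathrm{Node}(l,k',T'))$; else return $\mathrm{rotateLeft}(\mathrm{Node}(l,k',\mathrm{rotateRight}(T')))$; join calls joinRightWB if $T_l,T_r$ are not like and $w(T_l)>w(T_r)$, the mirror joinLeftWB if not like and $w(T_r)>w(T_l)$, else returns $\mathrm{Node}(T_l,k,T_r)$. Treap: if $k$'s priority exceeds those of the roots of $T_l,T_r$ return $\mathrm{Node}(T_l,k,T_r)$; else if the root of $T_l$ has higher priority than that of $T_r$ (or $T_r$ empty) return $\mathrm{Node}(L(T_l),k(T_l),\mathrm{join}(R(T_l),k,T_r))$; else return $\mathrm{Node}(\mathrm{join}(T_l,k,L(T_r)),k(T_r),R(T_r))$. *)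

(* Defs.v *)
From HB Require Import structures.
From mathcomp Require Import all_boot all_order all_algebra.
From mathcomp Require Import all_classical all_reals all_analysis.

Set Implicit Arguments.
Unset Strict Implicit.
Unset Printing Implicit Defensive.

Import Order.TTheory GRing.Theory Num.Theory.
Local Open Scope ring_scope.

(** * Computations with a work count

    [(n, Some a)] has performed [n] constant-time operations and returned [a];
    [(n, None)] is stuck: an empty tree was exposed, or a rotation was applied
    to a tree of the wrong shape. *)

Definition comp (A : Type) : Type := (nat * option A)%type.

Definition work (A : Type) (m : comp A) : nat := m.1.
Definition result (A : Type) (m : comp A) : option A := m.2.

Definition ret (A : Type) (a : A) : comp A := (0%N, Some a).
Definition step (A : Type) (a : A) : comp A := (1%N, Some a).
Definition stuck (A : Type) : comp A := (0%N, None).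

Definition bind (A B : Type) (m : comp A) (f : A -> comp B) : comp B :=
  match m with
  | (n, Some a) => ((n + work (f a))%N, result (f a))
  | (n, None) => (n, None)
  end.

Notation "'let*' x := m 'in' e" := (bind m (fun x => e))
  (at level 200, x pattern, m at level 200, e at level 200,
   format "'let*'  x  :=  m  'in' '//' e").

(** * Binary trees *)

Inductive tree (A : Type) : Type :=
| Leaf
| Node of tree A & A & tree A.
Arguments Leaf {A}.

Section Trees.
Context {A : Type}.
Implicit Types (T l r : tree A) (k : A).

Fixpoint tree_size T : nat :=
  if T is Node l _ r then (tree_size l + tree_size r).+1 else 0%N.

Definition weight T : nat := (tree_size T).+1.

Fixpoint height T : nat :=
  if T is Node l _ r then (maxn (height l) (height r)).+1 else 0%N.

Fixpoint inorder T : seq A :=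
  if T is Node l k r then inorder l ++ k :: inorder r else [::].

Definition expose T : comp (tree A * A * tree A) :=
  if T is Node l k r then step (l, k, r) else stuck _.

Definition node l k r : comp (tree A) := step (Node l k r).

Definition rotateLeft T : comp (tree A) :=
  if T is Node a x (Node b y c) then step (Node (Node a x b) y c) else stuck _.

Definition rotateRight T : comp (tree A) :=
  if T is Node (Node a x b) y c then step (Node a x (Node b y c)) else stuck _.

End Trees.

(** In the recursive functions below, [let* _ := step tt in] next to a [match]
    on an argument is the charge for exposing it, and [step b] for a boolean [b]
    is a test on the data stored in the nodes (height, colour, black height,
    weight, priority). *)

(** * AVL trees *)

Section AVL.
Context {K : Type}.
Implicit Types (T Tl Tr : tree K) (k : K).

Fixpoint avl T : bool :=
  if T is Node l _ r then
    [&& (height l <= (height r).+1)%N, (height r <= (height l).+1)%N,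
        avl l & avl r]
  else true.

Definition avl_rank T : int := (height T)%:Z - 1.

Fixpoint avl_joinRight Tl k Tr : comp (tree K) :=
  if Tl is Node l k' c then
    let* _ := step tt in
    let* b := step (height c <= (height Tr).+1)%N in
    if b then
      let* T' := node c k Tr in
      let* b' := step (height T' <= (height l).+1)%N in
      if b' then node l k' T'
      else
        let* T1 := rotateRight T' in
        let* T2 := node l k' T1 in
        rotateLeft T2
    else
      let* T' := avl_joinRight c k Tr in
      let* T'' := node l k' T' in
      let* b' := step (height T' <= (height l).+1)%N in
      if b' then ret T'' else rotateLeft T''
  else stuck _.

Fixpoint avl_joinLeft Tl k Tr : comp (tree K) :=
  if Tr is Node c k' r then
    let* _ := step tt in
    let* b := step (height c <= (height Tl).+1)%N in
    if b then
      let* T' := node Tl k c in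
      let* b' := step (height T' <= (height r).+1)%N in
      if b' then node T' k' r
      else
        let* T1 := rotateLeft T' in
        let* T2 := node T1 k' r in
        rotateRight T2
    else
      let* T' := avl_joinLeft Tl k c in
      let* T'' := node T' k' r in
      let* b' := step (height T' <= (height r).+1)%N in
      if b' then ret T'' else rotateRight T''
  else stuck _.

Definition avl_join Tl k Tr : comp (tree K) :=
  let* b := step ((height Tr).+1 < height Tl)%N in
  if b then avl_joinRight Tl k Tr
  else
    let* b' := step ((height Tl).+1 < height Tr)%N in
    if b' then avl_joinLeft Tl k Tr else node Tl k Tr.

End AVL.

(** * Red-black trees *)

Inductive color : Type := Red | Black.

Definition is_black (c : color) : bool := if c is Black then true else false.

Section RB.
Context {K : Type}.
Notation rbtree := (tree (K * color)).
Implicit Types (T Tl Tr : rbtree) (k : K).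

Definition root_black T : bool := if T is Node _ (_, c) _ then is_black c else true.

(** The number of black nodes on each downward path from the root to a leaf,
    from the leftmost path to the rightmost one.  Leaves are black nodes and are
    counted; not counting them would shift all black heights by 1 and all ranks
    by 2. *)
Fixpoint black_counts T : seq nat :=
  if T is Node l (_, c) r then
    [seq (is_black c + n)%N | n <- black_counts l ++ black_counts r]
  else [:: 1%N].

Definition bh T : nat := head 0%N (black_counts T).

Fixpoint no_red_red T : bool :=
  if T is Node l (_, c) r then
    [&& is_black c || (root_black l && root_black r), no_red_red l & no_red_red r]
  else true.

Definition rb T : bool := no_red_red T && constant (black_counts T).

Definition rb_rank T : int :=
  if root_black T then ((bh T)%:Z - 1) *+ 2 else (bh T)%:Z *+ 2 - 1.

Definition rb_fixRight T : comp rbtree :=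
  let* _ := step tt in
  match T with
  | Node a (x, Black) (Node b (y, Red) (Node c (z, Red) d)) =>
      let* T' := step (Node a (x, Black) (Node b (y, Red) (Node c (z, Black) d))) in
      rotateLeft T'
  | _ => ret T
  end.

Definition rb_fixLeft T : comp rbtree :=
  let* _ := step tt in
  match T with
  | Node (Node (Node a (x, Red) b) (y, Red) c) (z, Black) d =>
      let* T' := step (Node (Node (Node a (x, Black) b) (y, Red) c) (z, Black) d) in
      rotateRight T'
  | _ => ret T
  end.

Fixpoint rb_joinRight Tl k Tr : comp rbtree :=
  let* b := step (root_black Tl && (bh Tl == bh Tr)) in
  if b then node Tl (k, Red) Tr
  else if Tl is Node l x c then
    let* _ := step tt in
    let* T' := rb_joinRight c k Tr in
    let* T'' := node l x T' in
    rb_fixRight T''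
  else stuck _.

Fixpoint rb_joinLeft Tl k Tr : comp rbtree :=
  let* b := step (root_black Tr && (bh Tr == bh Tl)) in
  if b then node Tl (k, Red) Tr
  else if Tr is Node c x r then
    let* _ := step tt in
    let* T' := rb_joinLeft Tl k c in
    let* T'' := node T' x r in
    rb_fixLeft T''
  else stuck _.

Definition rb_join Tl k Tr : comp rbtree :=
  let* b := step (bh Tl == bh Tr) in
  if b then
    let* b' := step (root_black Tl && root_black Tr) in
    node Tl (k, if b' then Red else Black) Tr
  else
    let* b' := step (bh Tr < bh Tl)%N in
    if b' then
      let* T := rb_joinRight Tl k Tr in
      let* _ := step tt in
      match T with
      | Node a (x, Red) (Node _ (_, Red) _ as r) => step (Node a (x, Black) r)
      | _ => ret T
      end
    else
      let* T := rb_joinLeft Tl k Tr in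
      let* _ := step tt in
      match T with
      | Node (Node _ (_, Red) _ as l) (x, Red) b => step (Node l (x, Black) b)
      | _ => ret T
      end.

End RB.

(** * Weight-balanced trees *)

(** [up_log 2 n] is the ceiling of the binary logarithm of [n]. *)
Definition log_rank (A : Type) (T : tree A) : int := (up_log 2 (weight T))%:Z - 1.

Section WB.
Context {R : realType} {K : Type}.
Variable alpha : R.
Implicit Types (T Tl Tr : tree K) (k : K).

(** [weight T1 + weight T2] is the weight of [Node T1 v T2] for every [v]. *)
Definition like T1 T2 : bool :=
  alpha <= (weight T1)%:R / (weight T1 + weight T2)%:R <= 1 - alpha.

Fixpoint wb T : bool :=
  if T is Node l _ r then [&& like l r, wb l & wb r] else true.

Fixpoint wb_joinRight Tl k Tr : comp (tree K) :=
  let* b := step (like Tl Tr) in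
  if b then node Tl k Tr
  else if Tl is Node l k' c then
    let* _ := step tt in
    let* T' := wb_joinRight c k Tr in
    let* (l1, k1, r1) := expose T' in
    let* b1 := step (like l T') in
    if b1 then node l k' T'
    else
      let* b2 := step (like l l1 && like (Node l k' l1) r1) in
      if b2 then
        let* T'' := node l k' T' in
        rotateLeft T''
      else
        let* T1 := rotateRight T' in
        let* T2 := node l k' T1 in
        rotateLeft T2
  else stuck _.

Fixpoint wb_joinLeft Tl k Tr : comp (tree K) :=
  let* b := step (like Tl Tr) in
  if b then node Tl k Tr
  else if Tr is Node c k' r then
    let* _ := step tt in
    let* T' := wb_joinLeft Tl k c in
    let* (l1, k1, r1) := expose T' in
    let* b1 := step (like T' r) in
    if b1 then node T' k' r
    else
      let* b2 := step (like r1 r && like l1 (Node r1 k' r)) in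
      if b2 then
        let* T'' := node T' k' r in
        rotateRight T''
      else
        let* T1 := rotateLeft T' in
        let* T2 := node T1 k' r in
        rotateRight T2
  else stuck _.

Definition wb_join Tl k Tr : comp (tree K) :=
  let* b := step (~~ like Tl Tr && (weight Tr < weight Tl)%N) in
  if b then wb_joinRight Tl k Tr
  else
    let* b' := step (~~ like Tl Tr && (weight Tl < weight Tr)%N) in
    if b' then wb_joinLeft Tl k Tr else node Tl k Tr.

End WB.

(** * Treaps *)

Section Treap.
Context {R : realType} {K : Type}.
Variable prio : K -> R.
Implicit Types (T Tl Tr : tree K) (k : K).

Fixpoint treap T : bool :=
  if T is Node l k r then
    [&& all (fun x => prio x <= prio k) (inorder l ++ inorder r),
        treap l & treap r]
  else true.

Definition exceeds_root k T : bool :=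
  if T is Node _ x _ then prio x < prio k else true.

Definition higher_root Tl Tr : bool :=
  match Tl, Tr with
  | Node _ x _, Node _ y _ => prio y < prio x
  | Node _ _ _, Leaf => true
  | Leaf, _ => false
  end.

Fixpoint treap_join Tl k : tree K -> comp (tree K) :=
  fix treap_join_Tl Tr : comp (tree K) :=
    let* b := step (exceeds_root k Tl && exceeds_root k Tr) in
    if b then node Tl k Tr
    else
      let* b' := step (higher_root Tl Tr) in
      if b' then
        if Tl is Node l x c then
          let* _ := step tt in
          let* T' := treap_join c k Tr in
          node l x T'
        else stuck _
      else
        if Tr is Node c x r then
          let* _ := step tt in
          let* T' := treap_join_Tl c in
          node T' x r
        else stuck _.

(** [k] has the [prio_position k s]-th highest priority among the keys [s]. *)
Definition prio_position k (s : seq K) : nat :=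
  (count (fun x => prio k < prio x) s).+1.

End Treap.

(** * Random priorities *)

Section Probability.
Local Open Scope classical_set_scope.
Local Open Scope ereal_scope.
Context {d : measure_display} {Omega : measurableType d} {R : realType}.
Variable P : probability Omega R.

Definition mutually_independent (K : eqType) (s : seq K)
    (X : K -> {RV P >-> R}) : Prop :=
  forall (u : seq K) (B : K -> set R),
    uniq u -> {subset u <= s} -> (forall x, measurable (B x)) ->
    P (\bigcap_(x in [set` u]) X x @^-1` B x) =
    \prod_(x <- u) P (X x @^-1` B x).

Definition uniform01 (X : {RV P >-> R}) : Prop :=
  forall B : set R, measurable B ->
    distribution P X B = uniform_prob (@ltr01 R) B.

(** The expectation of [X] given an event [E] of positive probability. *)
Definition cond_expectation (E : set Omega) (X : Omega -> R) : \bar R :=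
  ((fine (P E))^-1)%:E * \int[P]_(w in E) (X w)%:E.

End Probability.

(* Main.v *)
Require Import Defs.
From HB Require Import structures.
From mathcomp Require Import all_boot all_order all_algebra.
From mathcomp Require Import all_classical all_reals all_analysis.
From mathcomp Require Import fingroup perm measurable_realfun zify lra.

Set Implicit Arguments.
Unset Strict Implicit.
Unset Printing Implicit Defensive.

Import Order.TTheory GRing.Theory Num.Theory.
Local Open Scope ring_scope.

(** The work of [join] is proportional to the number of nodes it descends through,
    so the bounds for the deterministic schemes say that each step down loses a
    fixed amount of rank (a child of a weight-balanced tree has at most [9/11] of
    its weight, and [(11/9)^4 > 2]).  Sizes add up under [join], so for
    weight-balanced trees and treaps the rank bounds only require that no rotation
    gets stuck.

    For treaps, the descent visits keys of the two facing spines whose priority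
    exceeds that of [k], i.e. the right-to-left maxima of [sl] and the left-to-right
    maxima of [sr] above [k].  Only the comparison pattern of the priorities matters;
    it takes finitely many values and its law is invariant under permuting the keys
    and gives ties probability zero.  Given that [t - 1] keys beat [k], swapping keys
    shows that the [m]-th of those in [sl], counted from [k], is a maximum with
    probability [1/m], so the expected number of visits is at most twice the
    harmonic number of [t - 1]. *)

(** * Work and results of composed computations; mirror images of trees *)

Lemma work_bind_le (A B : Type) (m : Defs.comp A) (f : A -> Defs.comp B) (n : nat) :
  (forall a, (work (f a) <= n)%N) -> (work (bind m f) <= work m + n)%N.
Proof.
move=> h; case: m => a [b|] /=; rewrite /work /= ?leq_addr //.
by rewrite leq_add2l; apply: h.
Qed.

Lemma result_bind (A B : Type) (m : Defs.comp A) (f : A -> Defs.comp B) (a : A) :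
  result m = Some a -> result (bind m f) = result (f a).
Proof. by case: m => n [b|] //= [->]. Qed.

(** Relates a left join to the right join of the mirrored trees: same work, stuck together, results
    matched by [f]. *)
Definition comp_map (A B : Type) (f : A -> B) (m : Defs.comp A) : Defs.comp B :=
  (work m, omap f (result m)).

Lemma result_comp_map (A B : Type) (f : A -> B) (m : Defs.comp A) (a : A) :
  result m = Some a -> result (comp_map f m) = Some (f a).
Proof. by rewrite /comp_map /result /= => ->. Qed.

Fixpoint mirror (A : Type) (T : tree A) : tree A :=
  if T is Node l k r then Node (mirror r) k (mirror l) else Leaf.

Lemma mirrorK (A : Type) : involutive (@mirror A).
Proof. by elim=> //= l -> k r ->. Qed.

Lemma height_mirror (A : Type) (T : tree A) : height (mirror T) = height T.
Proof. by elim: T => //= l -> k r ->; rewrite maxnC. Qed.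

Lemma tree_size_mirror (A : Type) (T : tree A) :
  tree_size (mirror T) = tree_size T.
Proof. by elim: T => //= l -> k r ->; rewrite addnC. Qed.

Lemma weight_mirror (A : Type) (T : tree A) : weight (mirror T) = weight T.
Proof. by rewrite /weight tree_size_mirror. Qed.

Lemma weight_Node (A : Type) (l r : tree A) k :
  weight (Node l k r) = (weight l + weight r)%N.
Proof. by rewrite /weight /= addnS. Qed.

(** * AVL trees *)

Section AVLJoin.
Context {K : Type}.
Implicit Types (T Tl Tr : tree K) (k : K).

Lemma avl_mirror T : avl (mirror T) = avl T.
Proof.
elim: T => //= l -> k r ->; rewrite !height_mirror.
by case: (_ <= _)%N; case: (_ <= _)%N; case: (avl l); case: (avl r).
Qed.

(** Both algorithms make the same tests and charges on mirrored data, so work and height bounds are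
    only proved for [avl_joinRight]. *)
Lemma avl_joinLeft_mirror Tl k Tr :
  avl_joinLeft Tl k Tr =
  comp_map (@mirror K) (avl_joinRight (mirror Tr) k (mirror Tl)).
Proof.
elim: Tr => //= c IH k' r _; rewrite !height_mirror.
case: ifP => _.
  rewrite (maxnC (height Tl)).
  case: ifP => _; rewrite /comp_map /=; rewrite ?mirrorK //.
  by case: (c) => //= c1 k1 c2; rewrite !mirrorK.
rewrite IH /comp_map; case: (avl_joinRight _ _ _) => n [T|] //=.
rewrite /work /= !height_mirror.
case: ifP => _; rewrite /= ?mirrorK //.
by case: T => //= a x b; rewrite !mirrorK.
Qed.

(** A recursive call passes to a child [c] that is still higher than [(height Tr).+1], so the
    truncated difference of heights drops by at least one and pays for the constant cost of the
    level. *)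
Lemma avl_joinRight_work Tl k Tr :
  (work (avl_joinRight Tl k Tr) <= 8 * (1 + (height Tl - height Tr)))%N.
Proof.
elim: Tl => // l _ k' c IH /=.
case: ifP => hc.
  case: ifP => _; rewrite /work /=; first by lia.
  by case: (c) => [|*] /=; lia.
set f := fun T' => _.
have : (work (bind (avl_joinRight c k Tr) f)
    <= work (avl_joinRight c k Tr) + 3)%N.
  apply: work_bind_le => T'; rewrite /f /work /=.
  by case: ifP => _ //=; case: T' => // ? ? [].
rewrite /work /=; move: IH hc; rewrite /work /=; lia.
Qed.

Lemma avl_joinRight_height Tl k Tr :
  avl Tl -> ((height Tr).+1 < height Tl)%N ->
  exists T, result (avl_joinRight Tl k Tr) = Some T /\
    (height Tl <= height T <= (height Tl).+1)%N.
Proof.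
elim: Tl => // l _ k' c IH /= /and4P[h1 h2 al ac] hTr.
case: ifP => hc.
  rewrite /node /step /=; case: ifP => hb /=.
    by eexists; split; [reflexivity | move=> /=; lia].
  (* [rotateRight] needs [c] to be a node. If [c] were a leaf, then [height Tr < height l] and the
     test [hb] would have succeeded. *)
  case: (c) hc h1 h2 hTr hb ac => [|c1 kc c2] /= hc h1 h2 hTr hb.
    by lia.
  by case/and4P => *; eexists; split; [reflexivity | move=> /=; lia].
have {}/IH : avl c by [].
case; first by lia.
move=> T' [eT' hT'].
rewrite (result_bind _ eT') /=.
case: ifP => hb /=.
  by eexists; split; [reflexivity | move=> /=; lia].
(* A leaf would have passed the test [hb], so [rotateLeft] finds a node. Here
   [height T' = height l + 2], and the rotation adds at most one to the height of the input. *)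
case: T' eT' hT' hb => [|a y b] _ /= hT' hb; first by lia.
by eexists; split; [reflexivity | move=> /=; lia].
Qed.

Lemma avl_join_work Tl k Tr :
  (work (avl_join Tl k Tr)
     <= 10 * (1 + absz (avl_rank Tl - avl_rank Tr)))%N.
Proof.
rewrite /avl_join /avl_rank /= /work /=.
case: ifP => h1.
  by have := avl_joinRight_work Tl k Tr; rewrite /work; lia.
case: ifP => h2 /=; last by lia.
rewrite avl_joinLeft_mirror /= /work /=.
have := avl_joinRight_work (mirror Tr) k (mirror Tl).
by rewrite /work !height_mirror; lia.
Qed.

Lemma avl_join_rank Tl k Tr :
  avl Tl -> avl Tr ->
  exists T, result (avl_join Tl k Tr) = Some T /\
    Num.max (avl_rank Tl) (avl_rank Tr) <= avl_rank T
      <= 1 + Num.max (avl_rank Tl) (avl_rank Tr).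
Proof.
move=> al ar; rewrite /avl_join /avl_rank /=.
case: ifP => h1.
  have [T [-> hT]] := avl_joinRight_height k al h1.
  by exists T; split=> //; lia.
case: ifP => h2 /=.
  rewrite avl_joinLeft_mirror /=.
  have [||T [-> hT]] := @avl_joinRight_height (mirror Tr) k (mirror Tl).
  - by rewrite avl_mirror.
  - by rewrite !height_mirror.
  exists (mirror T); split=> //.
  by move: hT; rewrite !height_mirror; lia.
by eexists; split; [reflexivity | move=> /=; lia].
Qed.

End AVLJoin.

(** * Red-black trees *)

Section RBJoin.
Context {K : Type}.
Notation rbtree := (tree (K * color)).
Implicit Types (T Tl Tr : rbtree) (k : K).

(** Naming the common value of the black counts makes the condition pass to subtrees, as in
    [balanced_Node]. *)
Definition balanced T (n : nat) : bool := all (pred1 n) (black_counts T).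

(** [root_black T || right_black T] fails exactly at a red root with a red right child, the shape
    that [rb_join] recolours at the end. *)
Definition right_black T : bool :=
  if T is Node _ _ r then root_black r else true.

Lemma black_counts_neq0 T : black_counts T != [::].
Proof.
elim: T => //= l IH [x c] r _.
by case: (black_counts l) IH.
Qed.

Lemma balanced_bh T n : balanced T n -> bh T = n.
Proof.
rewrite /balanced /bh; case: (black_counts T) (black_counts_neq0 T) => //= m s _.
by case/andP => /eqP.
Qed.

Lemma constant_balanced T : constant (black_counts T) = balanced T (bh T).
Proof.
by rewrite /balanced /bh; case: (black_counts T) => //= m s; rewrite eqxx.
Qed.

Lemma balanced_constant T n : balanced T n -> constant (black_counts T).
Proof. by move=> bT; rewrite constant_balanced (balanced_bh bT). Qed.

Lemma balanced_gt0 T n : balanced T n -> (0 < n)%N.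
Proof.
elim: T n => [|l IH [x c] r _] n; first by case: n.
rewrite /balanced /= all_map all_cat => /andP[+ _].
case: c => /= bl; first exact: IH.
case: n bl => // bl; have := black_counts_neq0 l.
by case: (black_counts l) bl => //= a s /andP[].
Qed.

Lemma balanced_Node l (x : K) c r n :
  balanced (Node l (x, c) r) (is_black c + n) = balanced l n && balanced r n.
Proof.
rewrite /balanced /= all_map all_cat.
have e : preim [eta addn (is_black c)] (pred1 (is_black c + n)%N) =1 pred1 n.
  by move=> m /=; rewrite eqn_add2l.
by rewrite !(eq_all e).
Qed.

Lemma balanced_NodeE l (x : K) c r n :
  balanced (Node l (x, c) r) n ->
  exists m, [/\ n = (is_black c + m)%N, balanced l m & balanced r m].
Proof.
move=> b; have n0 := balanced_gt0 b; exists (n - is_black c)%N.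
have e : n = (is_black c + (n - is_black c))%N by case: c {b} => /=; lia.
by move: b; rewrite [in balanced _ n]e balanced_Node => /andP[].
Qed.

Lemma rbP T : reflect (no_red_red T /\ balanced T (bh T)) (rb T).
Proof. by rewrite /rb constant_balanced; apply: andP. Qed.

Lemma root_black_mirror T : root_black (mirror T) = root_black T.
Proof. by case: T => //= l [x c] r. Qed.

Lemma no_red_red_mirror T : no_red_red (mirror T) = no_red_red T.
Proof.
elim: T => //= l -> [x c] r ->; rewrite !root_black_mirror.
by rewrite [_ && root_black l]andbC [no_red_red r && _]andbC.
Qed.

Lemma black_counts_mirror T : black_counts (mirror T) = rev (black_counts T).
Proof. by elim: T => //= l IHl [x c] r IHr; rewrite -map_rev rev_cat IHl IHr. Qed.

Lemma balanced_mirror T n : balanced (mirror T) n = balanced T n.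
Proof. by rewrite /balanced black_counts_mirror all_rev. Qed.

Lemma bh_mirror T n : balanced T n -> bh (mirror T) = bh T.
Proof.
by move=> b; rewrite (balanced_bh b) (@balanced_bh _ n) ?balanced_mirror.
Qed.


Lemma rb_fixLeft_mirror T :
  rb_fixLeft T = comp_map (@mirror _) (rb_fixRight (mirror T)).
Proof.
case: T => [|[|[|a1 [x1 []] b1] [x []] b] [y []] r] //=;
  rewrite /comp_map /= ?mirrorK //.
all: by rewrite !mirrorK.
Qed.

(** [bh] reads the leftmost path, which mirroring turns into the rightmost one; balance makes the
    tests of the two runs agree. *)
Lemma rb_joinLeft_mirror Tl k Tr n m : balanced Tl n -> balanced Tr m ->
  rb_joinLeft Tl k Tr =
  comp_map (@mirror _) (rb_joinRight (mirror Tr) k (mirror Tl)).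
Proof.
move=> bl; elim: Tr m => [|c IH [x cx] r _] m br.
  rewrite /= (bh_mirror bl) /comp_map /=; case: ifP => //= _.
  by rewrite mirrorK.
have [m' [_ bc _]] := balanced_NodeE br.
rewrite [LHS]/= [rb_joinRight _ _ _]/= -[Node (mirror r) _ _]/(mirror (Node c (x, cx) r)).
rewrite (bh_mirror bl) (bh_mirror br); case: ifP => _ /=.
  by rewrite /comp_map /= !mirrorK.
rewrite (IH _ bc) /comp_map; case: (rb_joinRight _ _ _) => p [T|] //=.
have := rb_fixLeft_mirror (Node (mirror T) (x, cx) r).
by rewrite /rb_fixLeft /rb_fixRight /= mirrorK => -[/addnI -> ->].
Qed.

(** The measure [2 * (n - m) + ~~ root_black Tl] decreases at each level: below a black node [n]
    drops by one, and below a red node the root becomes black. A level costs at most 6. *)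
Lemma rb_joinRight_work Tl k Tr n m :
  no_red_red Tl -> balanced Tl n -> balanced Tr m -> (m <= n)%N ->
  (work (rb_joinRight Tl k Tr) <= 6 * (2 * (n - m) + ~~ root_black Tl) + 2)%N.
Proof.
move=> + + br; elim: Tl n => [|l _ [x c] r IH] n nrr bl mn.
  by rewrite /= /work /=; case: ifP => _ /=; lia.
have [n' [en _ bn']] := balanced_NodeE bl.
rewrite [rb_joinRight _ _ _]/= (balanced_bh bl) (balanced_bh br).
case: ifP => hb; first by rewrite /work /=; lia.
move: nrr => /= /and3P[nc _ nr].
have mn' : (m <= n')%N by move: hb en; case: c {bl nc} => /=; lia.
set f := fun T' => _.
have : (work (bind (rb_joinRight r k Tr) f)
    <= work (rb_joinRight r k Tr) + 4)%N.
  apply: work_bind_le => T'; rewrite /f /work /=.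
  by case: (c) => //; case: (T') => // ? [? []] // [] // ? [? []].
move: (work (bind _ _)) => wf; have := IH _ nr bn' mn'; rewrite /work /=.
move: hb nc en; case: c {f bl} => /=; last by lia.
by move=> _ /andP[_ ->] /=; lia.
Qed.

(** Each repair at a black node keeps the black height and leaves a red root with two black
    children. The last clause asks for [m < n] because for [m = n] the result can be a red node over
    [Tr], whose root may be red. *)
Lemma rb_joinRight_spec Tl k Tr n m :
  no_red_red Tl -> balanced Tl n -> balanced Tr m -> (m <= n)%N ->
  exists T, [/\ result (rb_joinRight Tl k Tr) = Some T, balanced T n,
    ~~ root_black Tl -> ~~ root_black T &
    (m < n)%N -> root_black Tl -> root_black T || right_black T].
Proof.
move=> + + br; elim: Tl n => [|l _ [x c] r IH] n nrr bl mn.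
  (* Leaves count as black, so a leaf has black height 1, the least possible; hence [m = 1] and the
     walk stops before exposing it. *)
  have n1 : n = 1%N by move: bl; rewrite /balanced /=; lia.
  have m1 : m = 1%N by have := balanced_gt0 br; lia.
  subst n m; rewrite /= (balanced_bh br) /bh /=.
  eexists; split; [reflexivity | | by [] | by []].
  by rewrite -[1%N]/(is_black Red + 1)%N balanced_Node br.
have [n' [en bl' bn']] := balanced_NodeE bl.
rewrite [rb_joinRight _ _ _]/= (balanced_bh bl) (balanced_bh br).
case: ifP => hb.
  have en' : n = m by lia.
  eexists; split; [reflexivity | | by [] | by lia].
  by rewrite -[n]/(is_black Red + n)%N balanced_Node bl /= en'.
move: nrr => /= /and3P[nc _ nr].
have mn' : (m <= n')%N by move: hb en; case: c {bl nc} => /=; lia.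
have [T' [eT' bT' _ _]] := IH _ nr bn' mn'.
rewrite (result_bind _ eT') {eT'} /=.
case: c nc bl en {hb} => /= nc bl en.
  exists (Node l (x, Red) T'); split => //.
  by rewrite en -[(0 + n')%N]/(is_black Red + n')%N balanced_Node bl'.
have bT : balanced (Node l (x, Black) T') n.
  by rewrite en -[(1 + n')%N]/(is_black Black + n')%N balanced_Node bl'.
case: T' bT' bT => [|a [y []] [|b [z []] d]] bT' bT;
  try by eexists; split; [reflexivity | exact: bT | by [] | by []].
eexists; split; [reflexivity | | by [] | by []].
have [n2 [e2 ba]] := balanced_NodeE bT'.
case/balanced_NodeE => n3 [e3 bb bd].
rewrite /= !add0n in e2 e3; subst n2 n3.
rewrite -[n]/(is_black Red + n)%N balanced_Node en.
rewrite -[(1 + n')%N]/(is_black Black + n')%N !balanced_Node bl' /=.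
by rewrite ba bb bd.
Qed.

Lemma rb_rankE T n : balanced T n ->
  rb_rank T = n%:Z *+ 2 - 2 + (~~ root_black T)%:Z.
Proof. by move=> b; rewrite /rb_rank (balanced_bh b); case: root_black => /=; lia. Qed.

Lemma rb_join_mirror Tl k Tr n m : balanced Tl n -> balanced Tr m ->
  rb_join Tl k Tr = comp_map (@mirror _) (rb_join (mirror Tr) k (mirror Tl)).
Proof.
move=> bl br; rewrite /rb_join /= (rb_joinLeft_mirror k bl br).
rewrite -{2}[Tr]mirrorK -{2}[Tl]mirrorK.
rewrite (@rb_joinLeft_mirror (mirror Tr) k (mirror Tl) m n) ?balanced_mirror //.
rewrite (bh_mirror bl) (bh_mirror br) !root_black_mirror !mirrorK eq_sym.
case: ltngtP => // _; rewrite /comp_map /=; last by rewrite !mirrorK andbC.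
all: by case: (rb_joinRight _ _ _) => p [[|a [x []] [|b [y []] c]]|] //=;
  rewrite /work /= ?mirrorK.
Qed.

Lemma rb_join_work_le Tl k Tr : rb Tl -> rb Tr -> (bh Tr <= bh Tl)%N ->
  (work (rb_join Tl k Tr) <= 18 * (1 + absz (rb_rank Tl - rb_rank Tr)))%N.
Proof.
move=> /rbP[nl bl] /rbP[nr br] le.
rewrite (rb_rankE bl) (rb_rankE br) /rb_join /work /=.
case: eqP => e /=; first by lia.
have lt : (bh Tr < bh Tl)%N by lia.
rewrite lt; set f := fun T => _.
have : (work (bind (rb_joinRight Tl k Tr) f)
    <= work (rb_joinRight Tl k Tr) + 2)%N.
  by apply: work_bind_le => -[|a [x []] [|b [y []] c]].
(* The measure in this bound exceeds the rank difference by at most the colour bit of [Tr]. *)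
have := rb_joinRight_work k nl bl br le.
by rewrite /work; lia.
Qed.

(** With unequal black heights the walk preserves [bh Tl], so the rank grows by at most the colour
    bit unless the root is recoloured. Constant black counts are carried along so that [bh], read
    off one path, is the true black height. *)
Lemma rb_join_rank_le Tl k Tr : rb Tl -> rb Tr -> (bh Tr <= bh Tl)%N ->
  exists T, [/\ result (rb_join Tl k Tr) = Some T,
    constant (black_counts T) &
    Num.max (rb_rank Tl) (rb_rank Tr) <= rb_rank T
      <= 1 + Num.max (rb_rank Tl) (rb_rank Tr)].
Proof.
move=> /rbP[nl bl] /rbP[nr br] le.
rewrite (rb_rankE bl) (rb_rankE br) /rb_join.
case: (eqVneq (bh Tl) (bh Tr)) => e /=.
  rewrite e; set c := if _ then _ else _.
  have bT : balanced (Node Tl (k, c) Tr) (is_black c + bh Tr).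
    by rewrite balanced_Node br -{1}e bl.
  eexists; split; [reflexivity | exact: balanced_constant bT |].
  rewrite (rb_rankE bT) /c {bT c}.
  by case: (root_black Tl); case: (root_black Tr) => /=; lia.
have lt : (bh Tr < bh Tl)%N by lia.
have [T [eT bT h1 h2]] := rb_joinRight_spec k nl bl br le.
rewrite lt (result_bind _ eT) /= {eT}; move: bT h1 (h2 lt) => {h2}.
have conclude T' : balanced T' (bh Tl) ->
    (~~ root_black Tl -> ~~ root_black T') ->
    exists T0, [/\ Some T' = Some T0, constant (black_counts T0) &
    Num.max ((bh Tl)%:Z *+ 2 - 2 + (~~ root_black Tl)%:Z)
      ((bh Tr)%:Z *+ 2 - 2 + (~~ root_black Tr)%:Z) <= rb_rank T0 <=
    1 + Num.max ((bh Tl)%:Z *+ 2 - 2 + (~~ root_black Tl)%:Z)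
      ((bh Tr)%:Z *+ 2 - 2 + (~~ root_black Tr)%:Z)].
  move=> bT h1; exists T'; split=> //; first exact: balanced_constant bT.
  by rewrite (rb_rankE bT); move: h1; do 3 case: (root_black _) => /=; lia.
case: T => [|a [x []] [|b [y []] c]] bT h1 h2; try exact: conclude.
(* A red root with a red right child cannot come from a black-rooted [Tl]. So the rank of [Tl] is
   odd, and recolouring raises it by exactly one. *)
have rl : ~~ root_black Tl by case: (root_black Tl) h2 => //= /(_ isT).
have bT' : balanced (Node a (x, Black) (Node b (y, Red) c)) (1 + bh Tl).
  have [n [-> ba bb]] := balanced_NodeE bT.
  by rewrite -[X in balanced _ X]/(is_black Black + n)%N balanced_Node ba.
eexists; split; [reflexivity | exact: balanced_constant bT' |].
by rewrite (rb_rankE bT') rl /=; case: (root_black Tr) => /=; lia.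
Qed.

Lemma rb_mirror T : rb (mirror T) = rb T.
Proof.
apply/rbP/rbP => -[]; rewrite no_red_red_mirror balanced_mirror => nT bT.
  by rewrite (balanced_bh bT).
by rewrite (bh_mirror bT).
Qed.

Lemma rb_rank_mirror T : rb T -> rb_rank (mirror T) = rb_rank T.
Proof.
move=> /rbP[_ bT]; rewrite (rb_rankE bT) (@rb_rankE _ (bh T)) ?balanced_mirror //.
by rewrite root_black_mirror.
Qed.

Lemma rb_join_work Tl k Tr : rb Tl -> rb Tr ->
  (work (rb_join Tl k Tr) <= 18 * (1 + absz (rb_rank Tl - rb_rank Tr)))%N.
Proof.
move=> rl rr; case: (leqP (bh Tr) (bh Tl)) => [|/ltnW] le.
  exact: rb_join_work_le.
have [_ bl] := rbP _ rl; have [_ br] := rbP _ rr.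
rewrite (rb_join_mirror k bl br) /work /= -(rb_rank_mirror rl).
rewrite -(rb_rank_mirror rr) distnC; apply: rb_join_work_le.
- by rewrite rb_mirror.
- by rewrite rb_mirror.
- by rewrite (bh_mirror bl) (bh_mirror br).
Qed.

Lemma rb_join_rank Tl k Tr : rb Tl -> rb Tr ->
  exists T, [/\ result (rb_join Tl k Tr) = Some T,
    constant (black_counts T) &
    Num.max (rb_rank Tl) (rb_rank Tr) <= rb_rank T
      <= 1 + Num.max (rb_rank Tl) (rb_rank Tr)].
Proof.
move=> rl rr; case: (leqP (bh Tr) (bh Tl)) => [|/ltnW] le.
  exact: rb_join_rank_le.
have [_ bl] := rbP _ rl; have [_ br] := rbP _ rr.
rewrite (rb_join_mirror k bl br).
have [|||T [eT cT rT]] := @rb_join_rank_le (mirror Tr) k (mirror Tl).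
- by rewrite rb_mirror.
- by rewrite rb_mirror.
- by rewrite (bh_mirror bl) (bh_mirror br).
have bT : balanced (mirror T) (bh T) by rewrite balanced_mirror -constant_balanced.
exists (mirror T); split; first exact: result_comp_map eT.
  exact: balanced_constant bT.
move: rT; rewrite (rb_rank_mirror rl) (rb_rank_mirror rr) maxC.
rewrite (rb_rankE bT) root_black_mirror (@rb_rankE T (bh T)) //.
by rewrite -constant_balanced.
Qed.

End RBJoin.

(** * Weight-balanced trees *)

Lemma weight_gt0 (A : Type) (T : tree A) : (0 < weight T)%N.
Proof. by []. Qed.

(** The sum of two weights lies between their maximum and its double, and doubling raises the
    rounded logarithm by one. *)
Lemma log_rank_weightD (A : Type) (Tl Tr T : tree A) :
  weight T = (weight Tl + weight Tr)%N ->
  Num.max (log_rank Tl) (log_rank Tr) <= log_rank T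
    <= 1 + Num.max (log_rank Tl) (log_rank Tr).
Proof.
move=> wT; rewrite /log_rank wT.
move: (weight Tl) (weight Tr) (weight_gt0 Tl) (weight_gt0 Tr) => a b a0 b0.
have h1 : (up_log 2 a <= up_log 2 (a + b))%N by apply: leq_up_log; lia.
have h2 : (up_log 2 b <= up_log 2 (a + b))%N by apply: leq_up_log; lia.
have h3 : (up_log 2 (a + b) <= (maxn (up_log 2 a) (up_log 2 b)).+1)%N.
  apply: up_log_min => //; rewrite expnS mul2n -addnn leq_add //.
    by apply: leq_trans (up_logP a (isT : (1 < 2)%N)) _; rewrite leq_exp2l ?leq_maxl.
  by apply: leq_trans (up_logP b (isT : (1 < 2)%N)) _; rewrite leq_exp2l ?leq_maxr.
by lia.
Qed.

Section WBJoin.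
Context {R : realType} {K : Type}.
Variable alpha : R.
(** The rational bound [3 / 10] stands in for [1 - 1 / Num.sqrt 2], which [wb_range] shows to be
    smaller; it keeps the arithmetic within [lra] and [nra]. *)
Hypotheses (alpha_gt : 2 / 11 < alpha) (alpha_le : alpha <= 3 / 10).
Implicit Types (T Tl Tr : tree K) (k : K).

Local Notation wt T := ((weight T)%:R : R).

Lemma weight_ge1 T : 1 <= wt T.
Proof. by rewrite ler1n. Qed.

Lemma wt_Node l k r : wt (Node l k r) = wt l + wt r.
Proof. by rewrite weight_Node natrD. Qed.

Lemma likeE T1 T2 : like alpha T1 T2 =
  (alpha * (wt T1 + wt T2) <= wt T1) && (alpha * (wt T1 + wt T2) <= wt T2).
Proof.
have h1 := weight_ge1 T1; have h2 := weight_ge1 T2.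
have h : 0 < wt T1 + wt T2 by lra.
rewrite /like natrD ler_pdivlMr // ler_pdivrMr //; congr (_ && _).
by apply/idP/idP; lra.
Qed.

Lemma likeC T1 T2 : like alpha T1 T2 = like alpha T2 T1.
Proof. by rewrite !likeE andbC [wt T1 + _]addrC. Qed.

Lemma like_mirror T1 T2 : like alpha (mirror T1) (mirror T2) = like alpha T1 T2.
Proof. by rewrite /like !weight_mirror. Qed.

Lemma wb_mirror T : wb alpha (mirror T) = wb alpha T.
Proof.
by elim: T => //= l -> k r ->; rewrite like_mirror likeC [wb _ r && _]andbC.
Qed.

Lemma wb_joinLeft_mirror Tl k Tr :
  wb_joinLeft alpha Tl k Tr =
  comp_map (@mirror K) (wb_joinRight alpha (mirror Tr) k (mirror Tl)).
Proof.
elim: Tr => [|c IH k' r _] /=.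
  by rewrite -[Leaf]/(mirror Leaf) like_mirror likeC; case: ifP; rewrite /= /comp_map /= ?mirrorK.
rewrite -[Node (mirror r) _ _]/(mirror (Node c k' r)) like_mirror likeC.
case: ifP => _; first by rewrite /= /comp_map /= ?mirrorK.
rewrite IH /comp_map; case: (wb_joinRight _ _ _ _) => n [[|l1 k1 r1]|] //=.
have -> : like alpha (Node (mirror r1) k1 (mirror l1)) r =
    like alpha (mirror r) (Node l1 k1 r1).
  by rewrite likeC -like_mirror /= !mirrorK.
have -> : like alpha (mirror l1) r = like alpha (mirror r) l1.
  by rewrite likeC -like_mirror /= !mirrorK.
have -> : like alpha (mirror r1) (Node (mirror l1) k' r) =
    like alpha (Node (mirror r) k' l1) r1.
  by rewrite likeC -like_mirror /= !mirrorK.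
rewrite /work /=; case: ifP => _; first by rewrite /= !mirrorK.
case: ifP => _; first by rewrite /= !mirrorK.
by case: l1 => [|l2 k2 r2] //=; rewrite !mirrorK.
Qed.

(** A pair that is not like has one side below the fraction [alpha]; the second hypothesis says that
    this is not [Tl]. *)
Lemma not_like_gt Tl Tr : ~~ like alpha Tl Tr ->
  alpha * wt Tr <= (1 - alpha) * wt Tl -> (1 - alpha) * wt Tr < alpha * wt Tl.
Proof. by rewrite likeE negb_and -!ltNge => /orP[]; lra. Qed.

(** Invariant of the descent: [Tr] never becomes too heavy for the current subtree. Combining the
    hypotheses gives [(1 - alpha) * wt Tr < wt c], and [alpha <= (1 - alpha) ^ 2] does the rest. *)
Lemma child_not_light l k c Tr : like alpha l c ->
  (1 - alpha) * wt Tr < alpha * wt (Node l k c) ->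
  alpha * wt Tr <= (1 - alpha) * wt c.
Proof.
rewrite likeE wt_Node => /andP[_ h1] h2.
have [ag al] := (alpha_gt, alpha_le).
have r1 := weight_ge1 Tr; have c1 := weight_ge1 c.
have h3 : 7 / 10 * wt Tr <= (1 - alpha) * wt Tr by rewrite ler_pM2r; lra.
have h4 : 7 / 10 * wt c <= (1 - alpha) * wt c by rewrite ler_pM2r; lra.
have h5 : alpha * wt Tr <= 3 / 10 * wt Tr by rewrite ler_pM2r; lra.
lra.
Qed.

(** [d] bounds the depth of the descent: a child keeps at most a fraction [1 - alpha < 9/11] of the
    weight. *)
Lemma wb_joinRight_work d Tl k Tr :
  wb alpha Tl -> alpha * wt Tr <= (1 - alpha) * wt Tl ->
  wt Tl <= wt Tr * (11 / 9) ^+ d ->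
  (work (wb_joinRight alpha Tl k Tr) <= 8 * d + 2)%N.
Proof.
elim: Tl d => [|l _ k' c IH] d wl hl hd.
  by rewrite /= /work; case: ifP => /= _; lia.
rewrite /=; case: ifP => /= [_|/negbT nl]; first by rewrite /work /=; lia.
have gt := not_like_gt nl hl.
(* For [d = 0] the tree [Tl] is no heavier than [Tr], which contradicts [gt] since [alpha < 1/2]. *)
case: d hd => [|d] hd.
  have r1 := weight_ge1 Tr; rewrite expr0 mulr1 in hd.
  exfalso; move: gt hd r1 alpha_gt alpha_le; move: (wt _) (wt _) => x y; nra.
move: wl => /= /and3P[lc _ wc].
have hc := child_not_light lc gt.
have hd' : wt c <= wt Tr * (11 / 9) ^+ d.
  move: lc hd; rewrite likeE wt_Node exprS mulrCA => /andP[h1 _].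
  have l1 := weight_ge1 l; have c1 := weight_ge1 c.
  have h2 : 2 / 11 * (wt l + wt c) <= alpha * (wt l + wt c).
    by rewrite ler_pM2r; have := alpha_gt; lra.
  by move: (wt Tr * _) => e; lra.
set f := fun T' => _.
have : (work (bind (wb_joinRight alpha c k Tr) f)
    <= work (wb_joinRight alpha c k Tr) + 6)%N.
  apply: work_bind_le => -[|l1 k1 r1] //; rewrite /f /=.
  case: ifP => _ //=; case: ifP => _ //=; rewrite /work /=.
  by case: (l1).
by have := IH _ wc hc hd'; rewrite /work /=; lia.
Qed.


Lemma weight_lt2 T : wt T < 2 -> weight T = 1%N.
Proof. by rewrite ltr_nat; have := weight_gt0 T; lia. Qed.

(* [rotateRight T'] is stuck only when the left child [l1] of [T'] is a leaf;
   the last clause describes such a [T'] well enough to see that one of the two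
   earlier tests then succeeds. *)
Lemma wb_joinRight_spec Tl k Tr :
  wb alpha Tl -> alpha * wt Tr <= (1 - alpha) * wt Tl ->
  exists l1 k1 r1,
    [/\ result (wb_joinRight alpha Tl k Tr) = Some (Node l1 k1 r1),
        weight (Node l1 k1 r1) = (weight Tl + weight Tr)%N &
        l1 = Leaf -> weight Tl = 1%N \/
          [/\ ~~ like alpha Tl Tr, like alpha l1 r1 & alpha * wt Tl <= 1]].
Proof.
elim: Tl => [|l _ k' c IH] wl hl.
  rewrite /=; case: ifP => [_|/negbT nl].
    by exists Leaf, k, Tr; split=> // _; left.
  have gt := not_like_gt nl hl; have := weight_ge1 Tr.
  by move: gt; rewrite -[wt Leaf]/1; move: (wt Tr) alpha_gt alpha_le => x; nra.
rewrite [wb_joinRight _ _ _ _]/=; case: ifP => [lk|/negbT nl].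
  by exists (Node l k' c), k, Tr; split=> //; rewrite weight_Node.
have gt := not_like_gt nl hl.
move: wl => /= /and3P[lc _ wc]; have hc := child_not_light lc gt.
have [l1 [k1 [r1 [e1 w1 leaf1]]]] := IH wc hc.
rewrite (result_bind _ e1) /=.
case: ifP => [lk'|/negbT nl'] /=.
  exists l, k', (Node l1 k1 r1); split=> //.
    by rewrite weight_Node w1 weight_Node addnA.
  (* If the left child [l] is a leaf, balance at the root of [Tl] bounds [alpha * wt Tl] by its
     weight 1. *)
  move=> el; right; split=> //; move: lc; rewrite likeE wt_Node el.
  by rewrite -[wt Leaf]/1 => /andP[].
case: ifP => [_|/negbT nl2] /=.
  eexists _, _, _; split; [reflexivity | | by []].
  move: w1; rewrite !weight_Node; lia.
case: l1 e1 w1 leaf1 nl' nl2 => [|l2 k2 r2] e1 w1 leaf1 nl' nl2; last first.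
  eexists _, _, _; split; [reflexivity | | by []].
  move: w1; rewrite !weight_Node; lia.
exfalso.
have W1 : 1 + wt r1 = wt c + wt Tr.
  by rewrite -natrD -w1 weight_Node natrD.
move: gt lc nl' nl2; rewrite !likeE !wt_Node -![wt Leaf]/1.
have hl1 := weight_ge1 l; have hc1 := weight_ge1 c; have hr1 := weight_ge1 Tr.
have [ag al] := (alpha_gt, alpha_le).
(* Weights are integers and [1 / (1 - alpha) <= 10/7 < 2]. *)
have Tr1 : (1 - alpha) * wt Tr < 1 -> wt Tr = 1.
  by move=> h; rewrite (@weight_lt2 Tr) //; move: h hr1; move: (wt Tr) => x; nra.
(* If [c] has weight 1, so has [Tr]; then [T'] has weight 2 and is like [l], against [nl']. *)
case: (leaf1 erefl) => [w1'|[nlc lc1 wc1]].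
  rewrite w1' in W1 * => gt /andP[lc1 lc2] nl' _.
  have wr1 : wt Tr = 1 by apply: Tr1; lra.
  have l2 : 2 <= wt l.
    rewrite ler_nat ltnNge; apply/negP; rewrite -(ler_nat R) => l1.
    by rewrite wr1 in gt; nra.
  by move: nl'; rewrite negb_and -!ltNge; case/orP; nra.
(* Otherwise [Tr] and [l] have weight 1 and [r1] weighs as much as [c]; then both halves of the
   single-rotation test hold, against [nl2]. *)
move=> gt /andP[lc2 lc3] nl' nl2.
have gtc := not_like_gt nlc hc.
have wr1 : wt Tr = 1 by apply: Tr1; lra.
have er1 : wt r1 = wt c by lra.
move: lc1; rewrite likeE -[wt Leaf]/1 er1 => /andP[lc1 _].
have wl1 : wt l = 1.
  rewrite (@weight_lt2 l) //.
  by move: nl'; rewrite er1 negb_and -!ltNge; case/orP; nra.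
move: nl2; rewrite er1 wl1 !negb_and -!ltNge; rewrite wr1 in gtc.
by case/orP=> /orP[]; nra.
Qed.

(* [wb_join] tests for a left-heavy pair first, hence the extra unit of work. *)
Lemma wb_join_mirror Tl k Tr : (weight Tl <= weight Tr)%N ->
  result (wb_join alpha Tl k Tr) =
    omap (@mirror K) (result (wb_join alpha (mirror Tr) k (mirror Tl))) /\
  (work (wb_join alpha Tl k Tr)
     <= (work (wb_join alpha (mirror Tr) k (mirror Tl))).+1)%N.
Proof.
rewrite /wb_join /= wb_joinLeft_mirror !like_mirror !weight_mirror likeC.
case: like => /=; first by rewrite !mirrorK.
by case: ltngtP => //=; rewrite ?mirrorK.
Qed.

Lemma wb_join_work_le Tl k Tr : wb alpha Tl -> wb alpha Tr ->
  (weight Tr <= weight Tl)%N ->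
  (work (wb_join alpha Tl k Tr)
     <= 36 * (1 + absz (log_rank Tl - log_rank Tr)))%N.
Proof.
move=> wl wr le; rewrite /wb_join /=.
case: ifP => [/andP[nl lt]|h1] /=; last first.
  by rewrite ltnNge le /= andbF /work /=; lia.
set D := absz _.
have hl : alpha * wt Tr <= (1 - alpha) * wt Tl.
  have := weight_ge1 Tr; have : wt Tr <= wt Tl by rewrite ler_nat.
  by move: (wt Tr) (wt Tl) alpha_le => x y; nra.
(* [D] units of rank and one for rounding give a factor [2 ^ D.+1], and [2 <= (11/9) ^ 4]. This
   depth makes the work at most [8 * (4 * D.+1) + 3], whence the constant 36. *)
have hd : wt Tl <= wt Tr * (11 / 9) ^+ (4 * D.+1).
  have hD : (weight Tl <= 2 ^ D.+1 * weight Tr)%N.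
    apply: leq_trans (up_logP (weight Tl) (isT : (1 < 2)%N)) _.
    apply: leq_trans (_ : 2 ^ (D + up_log 2 (weight Tr)) <= _)%N.
      by rewrite leq_exp2l // /D /log_rank; lia.
    rewrite expnD expnSr -mulnA leq_mul2l; apply/orP; right.
    have [w1|w1] := leqP (weight Tr) 1.
      by rewrite (_ : weight Tr = 1%N) // ; have := weight_gt0 Tr; lia.
    have := up_log_bounds (isT : (1 < 2)%N) w1.
    case: (up_log 2 (weight Tr)) => [|u] /=; first by lia.
    by rewrite expnS; lia.
  rewrite -(ler_nat R) natrM natrX in hD.
  apply: le_trans hD _; rewrite mulrC ler_wpM2l // exprM.
  by apply: lerXn2r; rewrite ?nnegrE; lra.
by have := wb_joinRight_work k wl hl hd; rewrite /work; lia.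
Qed.

Lemma wb_join_result_le Tl k Tr : wb alpha Tl -> wb alpha Tr ->
  (weight Tr <= weight Tl)%N ->
  exists T, result (wb_join alpha Tl k Tr) = Some T /\
    weight T = (weight Tl + weight Tr)%N.
Proof.
move=> wl wr le; rewrite /wb_join /=.
case: ifP => [/andP[nl lt]|h1] /=; last first.
  rewrite ltnNge le /= andbF; eexists; split; first reflexivity.
  by rewrite weight_Node.
have hl : alpha * wt Tr <= (1 - alpha) * wt Tl.
  have := weight_ge1 Tr; have : wt Tr <= wt Tl by rewrite ler_nat.
  by move: (wt Tr) (wt Tl) alpha_le => x y; nra.
have [l1 [k1 [r1 [e w _]]]] := wb_joinRight_spec k wl hl.
by exists (Node l1 k1 r1).
Qed.

Lemma wb_join_work Tl k Tr : wb alpha Tl -> wb alpha Tr ->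
  (work (wb_join alpha Tl k Tr)
     <= 37 * (1 + absz (log_rank Tl - log_rank Tr)))%N.
Proof.
move=> wl wr; case: (leqP (weight Tr) (weight Tl)) => [|/ltnW] le.
  by have := wb_join_work_le k wl wr le; lia.
have [_] := wb_join_mirror k le.
have := @wb_join_work_le (mirror Tr) k (mirror Tl).
rewrite !wb_mirror !weight_mirror => /(_ wr wl le).
by rewrite /log_rank !weight_mirror; lia.
Qed.

Lemma wb_join_rank Tl k Tr : wb alpha Tl -> wb alpha Tr ->
  exists T, result (wb_join alpha Tl k Tr) = Some T /\
    Num.max (log_rank Tl) (log_rank Tr) <= log_rank T
      <= 1 + Num.max (log_rank Tl) (log_rank Tr).
Proof.
move=> wl wr; case: (leqP (weight Tr) (weight Tl)) => [|/ltnW] le.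
  have [T [eT wT]] := wb_join_result_le k wl wr le.
  by exists T; split=> //; apply: log_rank_weightD.
have [-> _] := wb_join_mirror k le.
have := @wb_join_result_le (mirror Tr) k (mirror Tl).
rewrite !wb_mirror !weight_mirror => /(_ wr wl le) [T [-> wT]].
exists (mirror T); split=> //.
by apply: log_rank_weightD; rewrite weight_mirror wT addnC.
Qed.

End WBJoin.

(** * Treaps *)

Section TreapJoin.
Context {R : realType} {K : Type}.
Variable prio : K -> R.
Implicit Types (T Tl Tr : tree K) (k : K) (u : seq K).

(** The nested [fix] reduces only on constructors; this is its uniform unfolding. *)
Lemma treap_joinE Tl k Tr : treap_join prio Tl k Tr =
  let* b := step (exceeds_root prio k Tl && exceeds_root prio k Tr) in
  if b then node Tl k Tr
  else
    let* b' := step (higher_root prio Tl Tr) in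
    if b' then
      if Tl is Node l x c then
        let* _ := step tt in
        let* T' := treap_join prio c k Tr in
        node l x T'
      else stuck _
    else
      if Tr is Node c x r then
        let* _ := step tt in
        let* T' := treap_join prio Tl k c in
        node T' x r
      else stuck _.
Proof. by case: Tl; case: Tr. Qed.

Local Arguments treap_join : simpl never.

(** Never stuck: once the first test fails, one of the trees is nonempty, and [higher_root] selects
    a nonempty one. *)
Lemma treap_join_weight Tl k Tr :
  exists T, result (treap_join prio Tl k Tr) = Some T /\
    weight T = (weight Tl + weight Tr)%N.
Proof.
elim: Tl Tr => [|l _ x c IHc] Tr; elim: Tr => [|d IHd y r _].
- by exists (Node Leaf k Leaf).
- rewrite treap_joinE [bind _ _]/=; case: ifP => _.
    by eexists; split; [reflexivity|].
  have [T [eT wT]] := IHd; rewrite [result _]/= (result_bind _ eT).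
  by eexists; split; [reflexivity|]; rewrite !weight_Node wT addnA.
- rewrite treap_joinE [bind _ _]/=; case: ifP => _.
    by eexists; split; [reflexivity|]; rewrite !weight_Node.
  have [T [eT wT]] := IHc Leaf; rewrite [result _]/= (result_bind _ eT).
  by eexists; split; [reflexivity|]; rewrite !weight_Node wT addnA.
rewrite treap_joinE [bind _ _]/=; case: ifP => _.
  by eexists; split; [reflexivity|]; rewrite !weight_Node.
rewrite [result _]/=; case: ifP => _.
  have [T [eT wT]] := IHc (Node d y r); rewrite [result _]/= (result_bind _ eT).
  by eexists; split; [reflexivity|]; rewrite !weight_Node wT weight_Node addnA.
have [T [eT wT]] := IHd; rewrite [result _]/= (result_bind _ eT).
by eexists; split; [reflexivity|]; rewrite !weight_Node wT weight_Node addnA.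
Qed.

Fixpoint spine k T : nat :=
  if T is Node _ x r then (~~ (prio x < prio k)%R + spine k r)%N else 0%N.

(* The join descends only through nodes on the two facing spines, and the root
   it descends through has priority at least that of [k]. *)
Lemma treap_join_work Tl k Tr :
  (work (treap_join prio Tl k Tr)
     <= 4 * (spine k Tl + spine k (mirror Tr)) + 2)%N.
Proof.
elim: Tl Tr => [|l _ x c IHc] Tr; elim: Tr => [|d IHd y r _].
- by rewrite treap_joinE /work /=.
- rewrite treap_joinE /work /=; case: ifP => [_|hy] /=; first by lia.
  have := work_bind_le (treap_join prio Leaf k d) (f := fun T' => node T' y r)
    (n := 1) (fun=> isT).
  by move: IHd; rewrite /work /= ?hy /=; lia.
- rewrite treap_joinE /work /=; case: ifP => [_|hx] /=; first by lia.
  rewrite andbT in hx.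
  have := work_bind_le (treap_join prio c k Leaf) (f := fun T' => node l x T')
    (n := 1) (fun=> isT).
  by move: (IHc Leaf); rewrite /work /= ?hx /=; lia.
rewrite treap_joinE /work /=; case: ifP => [_|/negbT h] /=; first by lia.
case: ifP => [hyx|/negbT hyx] /=.
  have hx : (prio x < prio k) = false.
    apply/negbTE; move: h; rewrite negb_and => /orP[//|].
    by rewrite -!leNgt => ky; apply: le_trans ky (ltW hyx).
  have := work_bind_le (treap_join prio c k (Node d y r))
    (f := fun T' => node l x T') (n := 1) (fun=> isT).
  by move: (IHc (Node d y r)); rewrite /work /= ?hx /=; lia.
have hy : (prio y < prio k) = false.
  apply/negbTE; move: h; rewrite negb_and => /orP[|//].
  by move: hyx; rewrite -!leNgt => xy kx; apply: le_trans kx xy.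
have := work_bind_le (treap_join prio (Node l x c) k d)
  (f := fun T' => node T' y r) (n := 1) (fun=> isT).
by move: IHd; rewrite /work /= ?hy /=; lia.
Qed.

(** The number of right-to-left maxima of [u] with priority at least that of [k]. *)
Fixpoint records k u : nat :=
  if u is x :: u' then
    (~~ (prio x < prio k)%R && all (fun y => prio y <= prio x)%R u'
     + records k u')%N
  else 0%N.

Lemma records_cat k u v : (records k v <= records k (u ++ v))%N.
Proof. by elim: u => //= x u IH; apply: leq_trans IH (leq_addl _ _). Qed.

(** In order, a node of the right spine is followed within its subtree by its right subtree only,
    which it dominates; the left subtrees come earlier and can only add maxima. *)
Lemma spine_records k T : treap prio T -> (spine k T <= records k (inorder T))%N.
Proof.
elim: T => //= l _ x r IH /and3P[]; rewrite all_cat => /andP[_ ax] _ /IH h.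
apply: leq_trans (records_cat _ _ _) => /=.
by rewrite ax andbT leq_add2l.
Qed.

Lemma inorder_mirror T : inorder (mirror T) = rev (inorder T).
Proof.
by elim: T => //= l IHl x r IHr; rewrite IHl IHr rev_cat rev_cons cat_rcons.
Qed.

Lemma treap_mirror T : treap prio (mirror T) = treap prio T.
Proof.
elim: T => //= l IHl x r IHr; rewrite !inorder_mirror IHl IHr.
by rewrite !all_cat !all_rev andbC [all _ _ && _]andbC -!andbA; do 2 bool_congr.
Qed.

Lemma treap_join_work_records Tl k Tr : treap prio Tl -> treap prio Tr ->
  (work (treap_join prio Tl k Tr)
     <= 4 * (records k (inorder Tl) + records k (rev (inorder Tr))) + 2)%N.
Proof.
move=> hl hr; apply: leq_trans (treap_join_work _ _ _) _.
rewrite leq_add2r leq_mul2l leq_add ?spine_records //.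
by rewrite -inorder_mirror spine_records // treap_mirror.
Qed.

Lemma treap_join_rank Tl k Tr :
  exists T, result (treap_join prio Tl k Tr) = Some T /\
    Num.max (log_rank Tl) (log_rank Tr) <= log_rank T
      <= 1 + Num.max (log_rank Tl) (log_rank Tr).
Proof.
have [T [eT wT]] := treap_join_weight Tl k Tr.
by exists T; split=> //; apply: log_rank_weightD.
Qed.

End TreapJoin.

(** * Records in an exchangeable random order *)

Section Harmonic.
Context {R : realType}.

Definition harmonic_sum (n : nat) : R := \sum_(j < n) j.+1%:R^-1.

Lemma harmonic_sum_ge0 n : 0 <= harmonic_sum n.
Proof. by apply: sumr_ge0 => j _; rewrite invr_ge0. Qed.

Lemma harmonic_sumS n : harmonic_sum n.+1 = harmonic_sum n + n.+1%:R^-1.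
Proof. by rewrite /harmonic_sum big_ord_recr. Qed.

Lemma harmonic_sum_le m n : (m <= n)%N -> harmonic_sum m <= harmonic_sum n.
Proof.
elim: n => [|n IH]; first by rewrite leqn0 => /eqP ->.
rewrite leq_eqVlt => /orP[/eqP -> //|/IH h].
by rewrite harmonic_sumS; apply: le_trans h _; rewrite lerDl invr_ge0.
Qed.

(** Induction with [ln (1 + x) <= x] at [x = - 1 / (n + 2)]. *)
Lemma harmonic_sum_ln n : harmonic_sum n.+1 <= 1 + ln n.+1%:R.
Proof.
elim: n => [|n IH]; first by rewrite harmonic_sumS /harmonic_sum big_ord0 ln1 invr1; lra.
rewrite harmonic_sumS.
have n1 : 0 < n.+1%:R :> R by [].
have n2 : 0 < n.+2%:R :> R by [].
have : ln (n.+1%:R / n.+2%:R : R) <= n.+1%:R / n.+2%:R - 1.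
  have := @le_ln1Dx R (n.+1%:R / n.+2%:R - 1).
  rewrite subrKC; apply.
  by rewrite ltrBrDr addNr divr_gt0.
rewrite ln_div ?posrE //.
have -> : n.+1%:R / n.+2%:R - 1 = - n.+2%:R^-1 :> R.
  by rewrite -{1}[n.+1%:R](addrK 1) natr1 mulrBl divff // addrAC subrr sub0r mul1r.
move: IH; move: (ln n.+1%:R) (ln n.+2%:R) (harmonic_sum n.+1) (n.+2%:R^-1).
by move=> a b h i; lra.
Qed.

End Harmonic.

Section Patterns.
Context {R : realType} {I : finType}.

(** The comparison table of the priorities, as an element of a finite type: expectations become
    finite sums. *)
Definition pattern := {ffun I * I -> bool}.

Definition pattern_of (f : I -> R) : pattern := [ffun ij => f ij.1 < f ij.2].

Definition relabel (s : {perm I}) (c : pattern) : pattern :=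
  [ffun ij => c (s ij.1, s ij.2)].

Lemma pattern_ofE f i j : pattern_of f (i, j) = (f i < f j).
Proof. by rewrite ffunE. Qed.

Lemma relabelE s c i j : relabel s c (i, j) = c (s i, s j).
Proof. by rewrite ffunE. Qed.

Definition above (k : I) (c : pattern) (i : I) : bool := c (k, i).

Definition nabove (k : I) (c : pattern) (u : seq I) : nat := count (above k c) u.

Fixpoint pattern_records (k : I) (c : pattern) (u : seq I) : nat :=
  if u is x :: u' then
    (~~ c (x, k) && all (fun y => ~~ c (x, y)) u' + pattern_records k c u')%N
  else 0%N.

Lemma pattern_recordsE (f : I -> R) k u :
  pattern_records k (pattern_of f) u = records f k u.
Proof.
elim: u => //= x u ->; rewrite pattern_ofE; congr (nat_of_bool (_ && _) + _)%N.
by apply: eq_all => y; rewrite pattern_ofE leNgt.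
Qed.

Definition top_above (k : I) (c : pattern) (u : seq I) (y : I) : bool :=
  above k c y && all (fun z => [|| z == y, ~~ above k c z | c (z, y)]) u.

Lemma nabove_relabel (s : {perm I}) k c u : s k = k -> perm_eq [seq s i | i <- u] u ->
  nabove k (relabel s c) u = nabove k c u.
Proof.
move=> sk su; rewrite /nabove -[RHS](seq.permP su) count_map; apply: eq_count => i.
by rewrite /= /above relabelE sk.
Qed.

Lemma top_above_relabel (s : {perm I}) k c u x : s k = k -> perm_eq [seq s i | i <- u] u ->
  top_above k (relabel s c) u x = top_above k c u (s x).
Proof.
move=> sk su; rewrite /top_above -[in RHS](perm_all _ su) all_map /above relabelE sk.
congr (_ && _); apply: eq_all => z.
by rewrite /= /above !relabelE sk (inj_eq perm_inj).
Qed.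

Lemma perm_map_tperm (u : seq I) x y : uniq u -> x \in u -> y \in u ->
  perm_eq [seq tperm x y i | i <- u] u.
Proof.
move=> uu xu yu; apply: uniq_perm => //; first by rewrite map_inj_uniq //; exact: perm_inj.
have sub i : i \in u -> tperm x y i \in u by case: tpermP => [->|->|].
move=> i; apply/mapP/idP => [[j ju ->]|iu]; first exact: sub.
by exists (tperm x y i); [exact: sub | rewrite tpermK].
Qed.

(** An abstract law of the comparison pattern: exchangeable, and supported on patterns of tie-free
    priorities. *)
Variable p : pattern -> R.
Hypothesis p_ge0 : forall c, 0 <= p c.
Hypothesis p_relabel : forall s c, p (relabel s c) = p c.
Hypothesis p_supp : forall c, p c != 0 -> exists2 f : I -> R, injective f & c = pattern_of f.

Definition expect (F : pattern -> R) : R := \sum_c p c * F c.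

Lemma expect_relabel s F : expect F = expect (F \o relabel s).
Proof.
have rK t : cancel (relabel t) (relabel t^-1%g).
  by move=> c; apply/ffunP => -[i j]; rewrite !relabelE !permKV.
rewrite /expect (reindex (relabel s)) /=.
  by apply: eq_bigr => c _; rewrite p_relabel.
exists (relabel s^-1%g) => c _; first exact: rK.
by rewrite -{1}[s]invgK rK.
Qed.

Lemma expect_le F G : (forall c, p c != 0 -> F c <= G c) -> expect F <= expect G.
Proof.
move=> FG; apply: ler_sum => c _.
have [->|/FG h] := eqVneq (p c) 0; first by rewrite !mul0r.
exact: ler_wpM2l.
Qed.

Lemma expectD F G : expect (fun c => F c + G c) = expect F + expect G.
Proof. by rewrite /expect -big_split; apply: eq_bigr => c _; rewrite mulrDr. Qed.

Lemma expectZ a F : expect (fun c => a * F c) = a * expect F.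
Proof. by rewrite /expect mulr_sumr; apply: eq_bigr => c _; rewrite mulrCA. Qed.

Lemma expect_sum (J : Type) (u : seq J) (F : J -> pattern -> R) :
  expect (fun c => \sum_(y <- u) F y c) = \sum_(y <- u) expect (F y).
Proof.
rewrite /expect exchange_big /=.
by apply: eq_bigr => c _; rewrite mulr_sumr.
Qed.

(** Counted from zero: [t] keys beat [k], which is thus in position [t + 1]. *)
Definition position_event (k : I) (t : nat) (c : pattern) : R :=
  (nabove k c (enum I) == t)%:R.

Lemma position_event_relabel (s : {perm I}) k t c : s k = k ->
  position_event k t (relabel s c) = position_event k t c.
Proof.
move=> sk; rewrite /position_event nabove_relabel //.
apply: uniq_perm => [||i].
- by rewrite map_inj_uniq ?enum_uniq //; exact: perm_inj.
- exact: enum_uniq.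
rewrite mem_enum; apply/mapP.
by exists (s^-1 i)%g; rewrite ?mem_enum // permKV.
Qed.

Lemma sum_top_above_le1 k c u : p c != 0 -> uniq u ->
  \sum_(y <- u) (top_above k c u y)%:R <= 1 :> R.
Proof.
move=> /p_supp [f _ cf] uu.
have [/hasP[y yu ty]|/hasPn nt] := boolP (has (top_above k c u) u); last first.
  by rewrite big1_seq ?ler01 // => y /andP[_ /nt /negbTE ->].
rewrite (bigD1_seq y) //= ty big1_seq ?addr0 // => z /andP[zy zu].
have [tz|//] := boolP (top_above k c u z).
case/andP: ty => ay /allP /(_ z zu); case/andP: tz => az /allP /(_ y yu).
rewrite [y == z]eq_sym (negbTE zy) ay az /= cf !pattern_ofE => yz.
by rewrite (lt_gtF yz).
Qed.

(* Averaging over the swaps of [x] with the keys [y] of [u]: each key of [u]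
   above [k] is equally likely to be the topmost one. *)
Lemma expect_top_above k t u x : uniq u -> x \in u -> k \notin u ->
  expect (fun c => position_event k t c * (top_above k c u x)%:R) <=
  expect (fun c => position_event k t c *
    ((above k c x)%:R / (nabove k c u)%:R)).
Proof.
move=> uu xu ku.
(* Summed over the second key, [F x y] gives back the event that [x] is topmost; summed over the
   first, [F y x] is bounded because at most one key is topmost. *)
pose F x' y' c := position_event k t c * ((top_above k c u x')%:R *
   (above k c y')%:R / (nabove k c u)%:R).
have swap y : y \in u -> expect (F x y) = expect (F y x).
  move=> yu; rewrite (expect_relabel (tperm x y)); apply: eq_bigr => c _.
  have xk : x != k by apply: contraNneq ku => <-.
  have yk : y != k by apply: contraNneq ku => <-.
  have sk : tperm x y k = k by rewrite tpermD.
  have su := perm_map_tperm uu xu yu.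
  rewrite /F /= position_event_relabel // top_above_relabel // nabove_relabel //.
  by rewrite tpermL /above relabelE sk tpermR.
apply: le_trans (_ : expect (fun c => \sum_(y <- u) F x y c) <= _).
  apply: expect_le => c _; rewrite /F -mulr_sumr ler_wpM2l ?ler0n //.
  rewrite -mulr_suml -mulr_sumr -natr_sum.
  have [ta|] := boolP (top_above _ _ _ _); last by rewrite !mul0r.
  rewrite mul1r (_ : \sum_(i <- u) _ = nabove k c u)%N; last first.
    by rewrite /nabove -sum1_count [RHS]big_mkcond; apply: eq_bigr => i _; case: above.
  rewrite divff // pnatr_eq0 -lt0n -has_count; apply/hasP; exists x => //.
  by case/andP: ta.
rewrite expect_sum (eq_big_seq (fun y => expect (F y x))) // -expect_sum.
apply: expect_le => c pc; rewrite /F -mulr_sumr ler_wpM2l ?ler0n //.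
rewrite -mulr_suml -mulr_suml ler_wpM2r ?invr_ge0 //.
by rewrite ler_piMl // sum_top_above_le1.
Qed.

(** A maximum at the head [x] is the topmost key above [k] in [x :: u]. By [expect_top_above] it
    contributes at most the inverse of the number of such keys, which is the increment of the
    harmonic sum when [x] is above [k]. *)
Lemma expect_records k t u : uniq (k :: u) ->
  expect (fun c => position_event k t c * (pattern_records k c u)%:R) <=
  expect (fun c => position_event k t c * harmonic_sum (nabove k c u)).
Proof.
elim: u => [|x u IH]; rewrite /=.
  by move=> _; apply: expect_le => c _; rewrite mulr0 mulr_ge0 ?harmonic_sum_ge0.
rewrite inE negb_or => /andP[/andP[kx ku] /andP[xu uu]].
have uxu : uniq (x :: u) by rewrite /= xu.
have kxu : k \notin x :: u by rewrite inE negb_or kx.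
apply: le_trans (_ : expect (fun c => position_event k t c *
    (top_above k c (x :: u) x)%:R + position_event k t c * (pattern_records k c u)%:R) <= _).
  apply: expect_le => c /p_supp [f fI cf].
  rewrite -mulrDr ler_wpM2l ?ler0n //.
  rewrite natrD lerD2r ler_nat.
  have [/andP[xk /allP xa]|//] := boolP (_ && _).
  rewrite lt0n eqb0 negbK /top_above /above cf !pattern_ofE /= in xk xa *.
  (* Records compare weakly and [top_above] strictly; injectivity of [f] closes the gap. *)
  have neq i : i != x -> ~~ (f x < f i) -> f i < f x.
    by move=> ix; rewrite -leNgt lt_neqAle (inj_eq fI) ix.
  rewrite (neq k kx xk) eqxx /=; apply/allP => z zu.
  have zx : z != x by apply: contraNneq xu => <-.
  by rewrite !pattern_ofE (neq z zx) ?orbT //; have := xa z zu; rewrite pattern_ofE.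
rewrite expectD.
apply: le_trans (lerD (expect_top_above t uxu (mem_head _ _) kxu) (IH _)) _.
  by rewrite /= ku.
rewrite -expectD; apply: expect_le => c _; rewrite -mulrDr /nabove /= -/(nabove k c u).
case: (above k c x) => /=; last by rewrite mul0r add0r add0n.
by rewrite add1n harmonic_sumS addrC mul1r.
Qed.

Lemma expect_records_le k t u : uniq (k :: u) ->
  expect (fun c => position_event k t c * (pattern_records k c u)%:R) <=
  harmonic_sum t * expect (position_event k t).
Proof.
move=> uku; apply: le_trans (expect_records t uku) _.
rewrite -expectZ; apply: expect_le => c _; rewrite mulrC /position_event.
case: eqP => [<-|_]; last by rewrite !mulr0.
rewrite !mulr1; apply: harmonic_sum_le.
rewrite /nabove -!size_filter; apply: uniq_leq_size.
  by apply: filter_uniq; case/andP: uku.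
by move=> i; rewrite mem_filter => /andP[ai _]; rewrite mem_filter ai mem_enum.
Qed.

End Patterns.

(** * Exchangeability of the priorities *)

Section RandomOrder.
Local Open Scope classical_set_scope.

Lemma measurable_pattern_of (R : realType) (I : finType) (d : measure_display)
    (T : measurableType d) (Y : I -> T -> R) (c : pattern) :
  (forall i, measurable_fun setT (Y i)) ->
  measurable [set w | pattern_of (Y^~ w) = c].
Proof.
move=> mY; have -> : [set w | pattern_of (Y^~ w) = c] =
    \bigcap_(ij in [set: I * I]) [set w | (Y ij.1 w < Y ij.2 w) = c ij].
  apply/seteqP; split => w /= h; first by move=> [i j] _ /=; rewrite -h pattern_ofE.
  by apply/ffunP => -[i j]; rewrite pattern_ofE; apply: (h (i, j)).
apply: fin_bigcap_measurable; first exact: finite_finset.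
move=> [i j] _ /=.
have /(_ measurableT [set c (i, j)]) := measurable_fun_ltr (mY i) (mY j).
by rewrite setTI; apply.
Qed.

Section Exchangeability.
Import numFieldNormedType.Exports.
Context {R : realType} {I : finType}.

(** A pi-system generating the product sigma-algebra on [I -> R]. *)
Definition rectangles : set (set (I -> R)) :=
  [set A | exists2 B : I -> set R, (forall i, measurable (B i)) &
    A = [set f | forall i, B i (f i)]].

Local Notation T := (g_sigma_algebraType rectangles).

Lemma measurable_coordinate (i : I) :
  measurable_fun setT (fun f : T => (f i : R)).
Proof.
move=> _ B mB; rewrite setTI; apply: sub_sigma_algebra => /=.
exists (fun j => if j == i then B else setT).
  by move=> j; case: ifP => _; [exact: mB | exact: measurableT].
apply/seteqP; split => f /= h; last by have := h i; rewrite eqxx.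
by move=> j; case: ifP => // /eqP ->.
Qed.

Context {d : measure_display} {Omega : measurableType d}.
Variable P : probability Omega R.

Lemma measurable_family (Y : I -> Omega -> R) :
  (forall i, measurable_fun setT (Y i)) ->
  measurable_fun setT (fun w => (Y^~ w : T)).
Proof.
move=> mY; apply: (@measurability _ _ Omega T setT _ rectangles) => // _ [_ [B mB ->] <-].
rewrite setTI; have -> : (fun w => (Y^~ w : T)) @^-1` [set f | forall i, B i (f i)] =
    \bigcap_(i in [set: I]) Y i @^-1` B i.
  by apply/seteqP; split => w /= h i; [move=> _|]; exact: h.
apply: fin_bigcap_measurable; first exact: finite_finset.
by move=> i _; rewrite -[X in measurable X]setTI; exact: mY.
Qed.

(** Rectangles are stable under intersection and contain the whole space, so finite measures that
    agree on them are equal. *)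
Lemma family_law_unique (Y Z : I -> Omega -> R) :
  (forall i, measurable_fun setT (Y i)) -> (forall i, measurable_fun setT (Z i)) ->
  (forall B : I -> set R, (forall i, measurable (B i)) ->
    P (\bigcap_(i in [set: I]) Y i @^-1` B i) =
    P (\bigcap_(i in [set: I]) Z i @^-1` B i)) ->
  forall A : set T, measurable A ->
    P [set w | A (Y^~ w)] = P [set w | A (Z^~ w)].
Proof.
move=> mY mZ YZ A mA.
pose FY : {mfun Omega >-> T} := HB.pack (fun w => (Y^~ w : T))
  (isMeasurableFun.Build _ _ _ _ _ (measurable_family mY)).
pose FZ : {mfun Omega >-> T} := HB.pack (fun w => (Z^~ w : T))
  (isMeasurableFun.Build _ _ _ _ _ (measurable_family mZ)).
apply: (@measure_unique _ R T rectangles (fun=> setT) _ _ _ _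
  (distribution P FY) (distribution P FZ)) => //.
- move=> _ _ [B1 mB1 ->] [B2 mB2 ->]; exists (fun i => B1 i `&` B2 i).
    by move=> i; apply: measurableI.
  apply/seteqP; split => f /=; first by move=> [h1 h2] i; split.
  by move=> h; split=> i; have [] := h i.
- move=> _; exists (fun=> setT) => [i|]; first exact: measurableT.
  by apply/seteqP; split.
- by rewrite bigcup_const.
- move=> _ [B mB ->]; have := YZ B mB; rewrite /distribution /pushforward /=.
  have E (W : I -> Omega -> R) : \bigcap_(i in [set: I]) W i @^-1` B i =
      (fun w => (W^~ w : T)) @^-1` [set f | forall i, B i (f i)].
    by apply/seteqP; split => w /= h i; [apply: h|move=> _; apply: h].
  by rewrite !E.
- by move=> _; apply: le_lt_trans (probability_le1 _ _) (ltry 1); exact: measurableT.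
Qed.

Lemma pattern_law_unique (Y Z : I -> Omega -> R) (c : pattern) :
  (forall i, measurable_fun setT (Y i)) -> (forall i, measurable_fun setT (Z i)) ->
  (forall B : I -> set R, (forall i, measurable (B i)) ->
    P (\bigcap_(i in [set: I]) Y i @^-1` B i) =
    P (\bigcap_(i in [set: I]) Z i @^-1` B i)) ->
  P [set w | pattern_of (Y^~ w) = c] = P [set w | pattern_of (Z^~ w) = c].
Proof.
move=> mY mZ YZ.
apply: (family_law_unique mY mZ YZ (A := [set f : T | pattern_of f = c])).
exact: (measurable_pattern_of c measurable_coordinate).
Qed.

End Exchangeability.

(** The trees may depend on the outcome in any way, so the work is not known to be measurable. The
    integral of a nonnegative function is a supremum over simple functions below it, hence monotone
    regardless. *)
Lemma ge0_le_integral_nonmeasurable (d : measure_display) (T : measurableType d)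
    (R : realType) (mu : {measure set T -> \bar R}) (D : set T) (f g : T -> \bar R) :
  (forall x, D x -> (0 <= f x)%E) -> (forall x, D x -> (f x <= g x)%E) ->
  (\int[mu]_(x in D) f x <= \int[mu]_(x in D) g x)%E.
Proof.
move=> f0 fg; rewrite !ge0_integralE //; last first.
  by move=> x Dx; apply: le_trans (f0 x Dx) (fg x Dx).
apply: ereal_sup_le => _ [h hf <-]; exists h => // x.
apply: le_trans (hf x) _; rewrite !patchE; by case: ifPn => // /set_mem /fg.
Qed.

(** * Independent uniform priorities almost surely have no ties *)

Section Ties.
Context {R : realType} {d : measure_display} {Omega : measurableType d}.
Variable P : probability Omega R.

Lemma uniform01_preimage (X : {RV P >-> R}) (B : set R) : uniform01 X -> measurable B ->
  P (X @^-1` B) = uniform_prob (@ltr01 R) B.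
Proof. by move=> uX mB; rewrite -uX. Qed.

Lemma uniform01_itv_le (X : {RV P >-> R}) (a b : R) : uniform01 X -> a < b ->
  (P (X @^-1` `[a, b[) <= (b - a)%:E)%E.
Proof.
move=> uX ab; rewrite uniform01_preimage // /uniform_prob.
apply: le_trans (_ : (\int[lebesgue_measure]_(x in `[a, b[) (cst 1%E) x <= _)%E).
  apply: ge0_le_integral_nonmeasurable => x _.
    by rewrite lee_fin uniform_pdf_ge0 // ltr01.
  by rewrite lee_fin /uniform_pdf subr0 invr1; case: ifP.
by rewrite integral_cst //= mul1e lebesgue_measure_itv /= lte_fin ab.
Qed.

Lemma uniform01_outside (X : {RV P >-> R}) : uniform01 X ->
  P (X @^-1` ~` `[0, 1]) = 0%E.
Proof.
move=> uX; rewrite uniform01_preimage //; last exact: measurableC.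
by rewrite /uniform_prob integral_uniform_pdf setICl integral_set0.
Qed.

Lemma measurable_tie (X Y : {RV P >-> R}) : measurable [set w | X w = Y w].
Proof.
have /(_ setT measurableT [set true]) := measurable_fun_eqr
  (measurable_funP X) (measurable_funP Y).
rewrite setTI (_ : _ @^-1` _ = [set w | X w = Y w]); first by apply.
by apply/seteqP; split => w /= /eqP.
Qed.

(** Cut the unit interval into cells of length [1 / (n + 1)]: a tie puts both variables into one
    cell, and the squared cell probabilities sum to [O(1 / n)]. *)
Lemma tie_null (X Y : {RV P >-> R}) : uniform01 X -> uniform01 Y ->
  (forall A B, measurable A -> measurable B ->
    P (X @^-1` A `&` Y @^-1` B) = (P (X @^-1` A) * P (Y @^-1` B))%E) ->
  P [set w | X w = Y w] = 0%E.
Proof.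
move=> uX uY XY.
have mX (B : set R) : measurable B -> measurable (X @^-1` B).
  by move=> mB; rewrite -[X in measurable X]setTI; exact: measurable_funP.
have mY (B : set R) : measurable B -> measurable (Y @^-1` B).
  by move=> mB; rewrite -[X in measurable X]setTI; exact: measurable_funP.
have mtie := measurable_tie X Y.
have bound n : (P [set w | X w = Y w] <= (2 / n.+1%:R)%:E)%E.
  pose cell (i : nat) : set R := `[i%:R / n.+1%:R, i.+1%:R / n.+1%:R[.
  have mcell i : measurable (cell i) by exact: measurable_itv.
  pose C i := X @^-1` cell i `&` Y @^-1` cell i.
  have mC i : measurable (C i) by apply: measurableI; [exact: mX | exact: mY].
  (* Cells are half-open, so the endpoint 1 falls into an extra cell of index [n.+1]. *)
  pose U := (X @^-1` (~` `[0, 1])) `|` \big[setU/set0]_(i < n.+2) C i.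
  have m0 : measurable (X @^-1` (~` `[0, 1])) by apply: mX; exact: measurableC.
  have mU : measurable (\big[setU/set0]_(i < n.+2) C i).
    by apply: bigsetU_measurable => i _; exact: mC.
  apply: (@le_trans _ _ (P U)).
    apply: le_measure; [exact: mem_set | by apply: mem_set; exact: measurableU |].
    move=> w /= XYw; rewrite /U.
    have [Xw|Xw] := pselect ((`[0, 1] : set R) (X w)); [right | left; exact: Xw].
    move: Xw; rewrite /= in_itv /= => /andP[X0 X1].
    have n0 : 0 < n.+1%:R :> R by [].
    have /truncn_itv /andP[t1 t2] : 0 <= X w * n.+1%:R by rewrite mulr_ge0.
    set m := Num.truncn _ in t1 t2.
    have mn : (m < n.+2)%N.
      rewrite ltnS -(ler_nat R); apply: le_trans t1 _.
      by rewrite ler_piMl.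
    rewrite -bigcup_mkord; exists m => //=.
    by rewrite /C /cell /= !in_itv /= -XYw ler_pdivrMr // ltr_pdivlMr // t1 t2.
  apply: le_trans (measureU2 _ m0 mU) _.
  rewrite [X in (X + _)%E](uniform01_outside uX) add0e.
  apply: le_trans (Boole_inequality _ _) _ => //.
  apply: le_trans (_ : (\sum_(i < n.+2) ((n.+1%:R^-1) ^+ 2)%:E <= _)%E).
    apply: lee_sum => i _; rewrite expr2 EFinM.
    rewrite [X in (X <= _)%E](XY _ _ (mcell i) (mcell i)).
    have E : i.+1%:R / n.+1%:R - i%:R / n.+1%:R = n.+1%:R^-1 :> R.
      by rewrite -mulrBl -natrB // subSnn mul1r.
    have lt : i%:R / n.+1%:R < i.+1%:R / n.+1%:R :> R.
      by rewrite ltr_pM2r ?invr_gt0 // ltr_nat.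
    by apply: lee_pmul => //; rewrite -E uniform01_itv_le.
  rewrite sumEFin lee_fin sumr_const card_ord -[X in X <= _]mulr_natl expr2 mulrA.
  rewrite ler_pM2r ?invr_gt0 // ler_pdivrMr // -natrM ler_nat; lia.
apply/eqP; rewrite eq_le measure_ge0 andbT.
have fin : P [set w | X w = Y w] \is a fin_num by exact: fin_num_measure.
rewrite -(fineK fin) lee_fin leNgt; apply/negP => x0.
set x := fine _ in x0.
have := bound (Num.truncn (2 / x)); rewrite -(fineK fin) lee_fin -/x.
rewrite leNgt ltr_pdivrMr // => /negP; apply.
by rewrite mulrC -ltr_pdivrMr // truncnS_gt.
Qed.

End Ties.

(** * The law of the comparison pattern of the random priorities *)

Section RandomPattern.
Context {R : realType} {d : measure_display} {Omega : measurableType d}.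
Context {P : probability Omega R} {I : finType}.
Variable X : I -> {RV P >-> R}.
Hypothesis X_indep : forall B : I -> set R, (forall i, measurable (B i)) ->
  P (\bigcap_(i in [set: I]) X i @^-1` B i) = (\prod_i P (X i @^-1` B i))%E.
Hypothesis X_unif : forall i, uniform01 (X i).

Definition random_pattern (w : Omega) : pattern := pattern_of (X^~ w).

Definition pattern_prob (c : pattern) : R := fine (P (random_pattern @^-1` [set c])).

Lemma measurable_random_pattern c : measurable (random_pattern @^-1` [set c]).
Proof. by apply: measurable_pattern_of => i; exact: measurable_funP. Qed.

Lemma pattern_probE c : P (random_pattern @^-1` [set c]) = (pattern_prob c)%:E.
Proof.
by rewrite fineK //; apply: fin_num_measure; exact: measurable_random_pattern.
Qed.

Lemma pattern_prob_ge0 c : 0 <= pattern_prob c.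
Proof. by rewrite fine_ge0. Qed.

(** Permuting an independent, identically distributed family only reorders the product of its
    marginals, so its joint law is unchanged. *)
Lemma pattern_prob_relabel s c : pattern_prob (relabel s c) = pattern_prob c.
Proof.
apply: EFin_inj; rewrite -!pattern_probE.
have -> : random_pattern @^-1` [set relabel s c] =
    [set w | pattern_of (fun i => X ((s^-1)%g i) w) = c].
  apply/seteqP; split => w; rewrite /random_pattern /= => h.
    apply/ffunP => -[i j]; rewrite pattern_ofE -(pattern_ofE (X^~ w)) h relabelE.
    by rewrite !permKV.
  by rewrite -h; apply/ffunP => -[i j]; rewrite relabelE !pattern_ofE !permK.
apply: (pattern_law_unique (Y := fun i => X ((s^-1)%g i)) (Z := X)).
- by move=> i; exact: measurable_funP.
- by move=> i; exact: measurable_funP.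
move=> B mB; rewrite X_indep //.
have -> : \bigcap_(i in [set: I]) X ((s^-1)%g i) @^-1` B i =
    \bigcap_(i in [set: I]) X i @^-1` B (s i).
  apply/seteqP; split => w h i _ /=; first by have := h (s i) Logic.I; rewrite /= permK.
  by have := h ((s^-1)%g i) Logic.I; rewrite /= permKV.
rewrite (X_indep (B := fun i => B (s i))) //.
rewrite [RHS](reindex_inj (@perm_inj _ s)) /=; apply: eq_bigr => i _.
by rewrite !uniform01_preimage.
Qed.

Lemma pair_indep i j (A B : set R) : i != j -> measurable A -> measurable B ->
  P (X i @^-1` A `&` X j @^-1` B) = (P (X i @^-1` A) * P (X j @^-1` B))%E.
Proof.
move=> ij mA mB.
pose C l := if l == i then A else if l == j then B else setT.
have mC l : measurable (C l) by rewrite /C; case: ifP => // _; case: ifP.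
have := X_indep mC; rewrite (bigD1 i) //= (bigD1 j) ?[j == i]eq_sym //=.
rewrite /C eqxx [j == i]eq_sym (negbTE ij) eqxx big1 ?mule1; last first.
  by move=> l /andP[/negbTE -> /negbTE ->]; rewrite preimage_setT probability_setT.
move=> <-; congr (P _); apply/seteqP; split => w /=.
  by move=> [h1 h2] l _; case: eqP => [->|_] //; case: eqP => [->|].
move=> h; have := h i Logic.I; rewrite /= eqxx => h1; split=> //.
by have := h j Logic.I; rewrite /= [j == i]eq_sym (negbTE ij) eqxx.
Qed.

(** A pattern of positive probability is realised at some [w]. A tie at [w] can be read off the
    pattern, so the whole event would lie in a null set. *)
Lemma pattern_prob_supp c : pattern_prob c != 0 ->
  exists2 f : I -> R, injective f & c = pattern_of f.
Proof.
move=> pc.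
have [w cw] : exists w, random_pattern w = c.
  apply: contrapT => h; case/eqP: pc; rewrite /pattern_prob.
  rewrite (_ : _ @^-1` _ = set0) ?measure0 //.
  by apply/seteqP; split => // w /= hw; case: h; exists w.
exists (X^~ w) => [i j Xij|]; last by rewrite -cw.
apply/eqP; apply: contraNT pc => ij; apply/eqP/EFin_inj; rewrite -pattern_probE.
apply: (@subset_measure0 _ _ _ P _ [set w | X i w = X j w]).
- exact: measurable_random_pattern.
- exact: measurable_tie.
- move=> w' /= h; apply/eqP; rewrite eq_le !leNgt.
  rewrite -!(pattern_ofE (X^~ w')) -/(random_pattern w') h -cw !pattern_ofE Xij.
  by rewrite ltxx.
by apply: tie_null => // A B; exact: pair_indep.
Qed.

Lemma measurable_pattern_event (D : pred pattern) :
  measurable [set w | D (random_pattern w)].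
Proof.
have -> : [set w | D (random_pattern w)] =
    \bigcup_(c in [set c | D c]) random_pattern @^-1` [set c].
  apply/seteqP; split => w /=; first by move=> h; exists (random_pattern w).
  by move=> [c /= Dc ->].
apply: fin_bigcup_measurable; first exact: finite_finset.
by move=> c _; exact: measurable_random_pattern.
Qed.

Lemma integral_pattern (D : pred pattern) (G : pattern -> R) :
  (forall c, 0 <= G c) ->
  (\int[P]_(w in [set w | D (random_pattern w)]) (G (random_pattern w))%:E =
   (expect pattern_prob (fun c => (D c)%:R * G c))%:E)%E.
Proof.
move=> G0; set E := [set w | _].
have mE : measurable E by exact: measurable_pattern_event.
rewrite (eq_integral (fun w => \sum_(c <- enum pattern)
    ((G c)%:E * (\1_(random_pattern @^-1` [set c]) w)%:E))%E); last first.
  move=> w _; rewrite big_enum /= (bigD1 (random_pattern w)) //= big1 ?adde0.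
    by rewrite indicE mem_set // mule1.
  by move=> c /negP cw; rewrite indicE memNset ?mule0 //= => h; case: cw; apply/eqP.
rewrite ge0_integral_sum //; last first.
  by move=> c w _; rewrite -EFinM lee_fin mulr_ge0.
  move=> c; apply: emeasurable_funM; first exact: measurable_cst.
  apply/measurable_EFinP; apply: measurable_indic; exact: measurable_random_pattern.
rewrite /expect -sumEFin big_enum; apply: eq_bigr => c _.
rewrite ge0_integralZl_EFin //; last first.
  apply/measurable_EFinP; apply: measurable_indic; exact: measurable_random_pattern.
rewrite integral_indic //; last exact: measurable_random_pattern.
have -> : random_pattern @^-1` [set c] `&` E =
    if D c then random_pattern @^-1` [set c] else set0.
  apply/seteqP; split => w /=; first by move=> [cw]; rewrite /E /= cw => ->.
  by case: ifP => //= Dc h; split=> //; rewrite /E /= h.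
case: (D c).
  by rewrite [X in (_ * X)%E](pattern_probE c) mul1r mulrC.
by rewrite measure0 mule0 mul0r mulr0.
Qed.

End RandomPattern.

End RandomOrder.

(** * Conditional expectation of the work of a treap join *)

Section ExpectedWork.
Local Open Scope classical_set_scope.
Context {R : realType} {d : measure_display} {Omega : measurableType d}.
Context {P : probability Omega R} {I : finType}.
Variable X : I -> {RV P >-> R}.
Hypothesis X_indep : forall B : I -> set R, (forall i, measurable (B i)) ->
  P (\bigcap_(i in [set: I]) X i @^-1` B i) = (\prod_i P (X i @^-1` B i))%E.
Hypothesis X_unif : forall i, uniform01 (X i).

Lemma cond_expectation_records (k : I) (u v : seq I) (t : nat) (f : Omega -> R) :
  uniq (k :: u) -> uniq (k :: v) ->
  (forall w, 0 <= f w) ->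
  (forall w, f w <= 4 * (records (X^~ w) k u + records (X^~ w) k v)%:R + 2) ->
  (cond_expectation P [set w | nabove k (random_pattern X w) (enum I) == t] f
    <= (8 * harmonic_sum t + 2)%:E)%E.
Proof.
move=> uu uv f0 fle; set D := fun c => nabove k c (enum I) == t.
rewrite /cond_expectation -[[set w | _]]/[set w | D (random_pattern X w)].
set E := [set w | _].
have mE : measurable E by exact: measurable_pattern_event.
pose p := pattern_prob X.
have PE : P E = (expect p (position_event k t))%:E.
  have := integral_pattern X D (G := fun=> 1) (fun=> ler01).
  rewrite -/E integral_cst // mul1e => ->; congr (_%:E).
  by apply: eq_bigr => c _; rewrite mulr1.
pose G c : R := 4 * (pattern_records k c u + pattern_records k c v)%:R + 2.
have G0 c : 0 <= G c by rewrite addr_ge0 // mulr_ge0.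
have fG : (\int[P]_(w in E) (f w)%:E <=
    (expect p (fun c => position_event k t c * G c))%:E)%E.
  rewrite -(integral_pattern X D G0); apply: ge0_le_integral_nonmeasurable.
    by move=> w _; rewrite lee_fin.
  by move=> w _; rewrite lee_fin /G /random_pattern !pattern_recordsE.
have q0 : 0 <= expect p (position_event k t).
  by apply: sumr_ge0 => c _; rewrite mulr_ge0 ?pattern_prob_ge0 ?ler0n.
have H0 := @harmonic_sum_ge0 R t.
have le : expect p (fun c => position_event k t c * G c) <=
    (8 * harmonic_sum t + 2) * expect p (position_event k t).
  have hu := expect_records_le (pattern_prob_ge0 X) (pattern_prob_relabel X_indep X_unif)
    (pattern_prob_supp X_indep X_unif) t uu.
  have hv := expect_records_le (pattern_prob_ge0 X) (pattern_prob_relabel X_indep X_unif)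
    (pattern_prob_supp X_indep X_unif) t uv.
  have -> : expect p (fun c => position_event k t c * G c) =
      4 * expect p (fun c => position_event k t c * (pattern_records k c u)%:R) +
      4 * expect p (fun c => position_event k t c * (pattern_records k c v)%:R) +
      2 * expect p (position_event k t).
    rewrite -!expectZ -!expectD; apply: eq_bigr => c _; congr (_ * _).
    by rewrite /G natrD; move: (position_event k t c) => e; lra.
  move: hu hv; rewrite -/p; move: (expect p _) (expect p _) (expect p _).
  by move=> a b e; lra.
rewrite PE /=; set q := expect p (position_event k t) in q0 le *.
apply: le_trans (_ : ((q^-1)%:E * _ <= _)%E).
  by apply: lee_wpmul2l fG; rewrite lee_fin invr_ge0.
rewrite -EFinM lee_fin.
(* For an event of probability zero the inverse is 0 by convention, and the bound is trivial. *)
have [->|qn0] := eqVneq q 0; first by rewrite invr0 mul0r; lra.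
by rewrite mulrC ler_pdivrMr // lt0r qn0.
Qed.

End ExpectedWork.

Lemma records_map (R : realType) (J K : Type) (g : J -> K) (f : K -> R) (k : J) u :
  records f (g k) [seq g i | i <- u] = records (f \o g) k u.
Proof. by elim: u => //= x u ->; rewrite all_map. Qed.

Lemma harmonic_sum_le_ln (R : realType) (t : nat) :
  8 * harmonic_sum t + 2 <= 10 * (1 + ln t.+1%:R) :> R.
Proof.
have h0 n : 0 <= ln n.+1%:R :> R by rewrite ln_ge0 // ler1n.
case: t => [|t].
  by rewrite /harmonic_sum big_ord0; have := h0 0%N; lra.
have h1 := @harmonic_sum_ln R t.
have h2 : ln t.+1%:R <= ln t.+2%:R :> R by rewrite ler_ln ?posrE // ler_nat.
have := h0 t; move: h1 h2; move: (ln _) (ln _) (harmonic_sum _).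
by move=> a b c; lra.
Qed.

Lemma treap_join_expected_work (R : realType) (d : measure_display)
    (Omega : measurableType d) (P : probability Omega R) (K : eqType)
    (prio : K -> {RV P >-> R}) (sl sr : seq K) (k : K)
    (Tl Tr : Omega -> tree K) (t : nat) :
  uniq (sl ++ k :: sr) ->
  mutually_independent (sl ++ k :: sr) prio ->
  (forall x, x \in sl ++ k :: sr -> uniform01 (prio x)) ->
  (forall w, inorder (Tl w) = sl /\ treap (prio^~ w) (Tl w)) ->
  (forall w, inorder (Tr w) = sr /\ treap (prio^~ w) (Tr w)) ->
  (1 <= t)%N ->
  (cond_expectation P
     [set w | prio_position (prio^~ w) k (sl ++ k :: sr) = t]%classic
     (fun w => (work (treap_join (prio^~ w) (Tl w) k (Tr w)))%:R)
   <= (10 * (1 + ln t%:R))%:E)%E.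
Proof.
set s := sl ++ k :: sr => us ind unif hl hr; case: t => // t _.
pose g := tnth (in_tuple s).
(* Keys are replaced by their positions in [s], to work over a finite type. *)
have gs : [seq g i | i <- enum 'I_(size s)] = s by rewrite map_tnth_enum.
have gI : injective g by apply/tuple_uniqP.
have gin i : g i \in s by exact: mem_tnth.
have ks : (size sl < size s)%N by rewrite size_cat /= -addSnnS leq_addr.
pose k0 := Ordinal ks.
pose u := take (size sl) (enum 'I_(size s)).
(* Reversed because [records] looks from the far end towards [k], and [sr] faces [k] with its first
   key. *)
pose v := rev (drop (size sl).+1 (enum 'I_(size s))).
have gk : g k0 = k by rewrite /g (tnth_nth k) /= nth_cat ltnn subnn.
have gu : [seq g i | i <- u] = sl by rewrite map_take gs take_size_cat.
have gv : [seq g i | i <- v] = rev sr.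
  by rewrite map_rev map_drop gs -add1n -drop_drop drop_size_cat //= drop0.
have uk : uniq (k0 :: u).
  rewrite -(map_inj_uniq gI) map_cons gk gu.
  by move: us; rewrite /s uniq_catC /= mem_cat negb_or cat_uniq => /andP[/andP[_ ->] /and3P[_ _ ->]].
have vk : uniq (k0 :: v).
  rewrite -(map_inj_uniq gI) map_cons gk gv /= mem_rev rev_uniq.
  by move: us; rewrite cat_uniq => /and3P[].
pose X i := prio (g i).
have Xunif i : uniform01 (X i) by apply: unif.
have Xind (B : 'I_(size s) -> set R) : (forall i, measurable (B i)) ->
    P (\bigcap_(i in [set: 'I_(size s)]) X i @^-1` B i)%classic =
    (\prod_i P (X i @^-1` B i)%classic)%E.
  move=> mB.
  (* Carries the sets from positions to keys; [setT] is a default for keys outside [s]. *)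
  pose B' x := if [pick i | g i == x] is Some i then B i else setT.
  have B'g i : B' (g i) = B i.
    rewrite /B'; case: pickP => [j /eqP /gI -> //|/(_ i)].
    by rewrite eqxx.
  have := ind s B' us (fun x h => h).
  have mB' x : measurable (B' x) by rewrite /B'; case: pickP.
  move=> /(_ mB'); rewrite -{2}gs big_map big_enum /=.
  under eq_bigr do rewrite B'g.
  move=> <-; congr (P _); apply/seteqP; split => w /= h.
    move=> x /= xs; have /mapP[i _ ->] : x \in [seq g i | i <- enum 'I_(size s)].
      by rewrite gs.
    by rewrite B'g; exact: h.
  by move=> i _; have := h (g i) (gin i); rewrite /= B'g.
apply: le_trans (_ : ((8 * harmonic_sum t + 2)%:E <= _)%E); last first.
  by rewrite lee_fin; exact: harmonic_sum_le_ln.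
have -> : [set w | prio_position (prio^~ w) k s = t.+1]%classic =
    [set w | nabove k0 (random_pattern X w) (enum 'I_(size s)) == t]%classic.
  have E w : prio_position (prio^~ w) k s =
      (nabove k0 (random_pattern X w) (enum 'I_(size s))).+1.
    rewrite /prio_position -{1}gs count_map; congr S; apply: eq_count => i /=.
    by rewrite /above /random_pattern pattern_ofE /X gk.
  by apply/seteqP; split => w /=; rewrite E; [case=> ->|move/eqP ->].
apply: (cond_expectation_records Xind Xunif t uk vk) => w; first exact: ler0n.
have [il tl] := hl w; have [ir tr] := hr w.
have := treap_join_work_records k tl tr.
rewrite il ir -gu -gv -gk !records_map => h.
by rewrite -natrM -natrD ler_nat; exact: h.
Qed.

(** [Num.sqrt 2 <= 10/7] because [2 <= 100/49]. *)
Lemma wb_range (R : realType) (alpha : R) :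
  2 / 11 < alpha <= 1 - 1 / Num.sqrt 2 -> 2 / 11 < alpha /\ alpha <= 3 / 10.
Proof.
move=> /andP[h1 h2]; split=> //; apply: le_trans h2 _.
have s0 : 0 < Num.sqrt 2 :> R by rewrite sqrtr_gt0.
have s1 : Num.sqrt 2 <= 10 / 7 :> R.
  rewrite -(@ler_pXn2r _ 2) ?nnegrE ?sqrtr_ge0 // ?sqr_sqrtr //; lra.
have : 7 / 10 <= 1 / Num.sqrt 2 :> R by rewrite ler_pdivlMr //; lra.
by lra.
Qed.

Theorem theorem1 (R : realType) :
  [/\ (* work of join for AVL, red-black and weight-balanced trees *)
      [/\ exists C : nat, forall (K : Type) (Tl Tr : tree K) (k : K),
            avl Tl -> avl Tr ->
            (work (avl_join Tl k Tr)
               <= C * (1 + absz (avl_rank Tl - avl_rank Tr)))%N,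
          exists C : nat, forall (K : Type) (Tl Tr : tree (K * color)) (k : K),
            rb Tl -> rb Tr ->
            (work (rb_join Tl k Tr)
               <= C * (1 + absz (rb_rank Tl - rb_rank Tr)))%N &
          forall alpha : R, 2 / 11 < alpha <= 1 - 1 / Num.sqrt 2 ->
          exists C : nat, forall (K : Type) (Tl Tr : tree K) (k : K),
            wb alpha Tl -> wb alpha Tr ->
            (work (wb_join alpha Tl k Tr)
               <= C * (1 + absz (log_rank Tl - log_rank Tr)))%N],
      (* expected work of join for treaps *)
      exists C : R,
      forall (d : measure_display) (Omega : measurableType d)
             (P : probability Omega R) (K : eqType)
             (prio : K -> {RV P >-> R}) (sl sr : seq K) (k : K)
             (Tl Tr : Omega -> tree K) (t : nat),
        uniq (sl ++ k :: sr) ->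
        mutually_independent (sl ++ k :: sr) prio ->
        (forall x, x \in sl ++ k :: sr -> uniform01 (prio x)) ->
        (forall w, inorder (Tl w) = sl /\ treap (prio^~ w) (Tl w)) ->
        (forall w, inorder (Tr w) = sr /\ treap (prio^~ w) (Tr w)) ->
        (1 <= t <= size (sl ++ k :: sr))%N ->
        (cond_expectation P
           [set w | prio_position (prio^~ w) k (sl ++ k :: sr) = t]%classic
           (fun w => (work (treap_join (prio^~ w) (Tl w) k (Tr w)))%:R)
         <= (C * (1 + ln t%:R))%:E)%E &
      (* rank of the result for all four schemes *)
      [/\ forall (K : Type) (Tl Tr : tree K) (k : K),
            avl Tl -> avl Tr ->
            exists T, result (avl_join Tl k Tr) = Some T /\
              Num.max (avl_rank Tl) (avl_rank Tr) <= avl_rank T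
                <= 1 + Num.max (avl_rank Tl) (avl_rank Tr),
          forall (K : Type) (Tl Tr : tree (K * color)) (k : K),
            rb Tl -> rb Tr ->
            exists T, [/\ result (rb_join Tl k Tr) = Some T,
              constant (black_counts T) &
              Num.max (rb_rank Tl) (rb_rank Tr) <= rb_rank T
                <= 1 + Num.max (rb_rank Tl) (rb_rank Tr)],
          forall alpha : R, 2 / 11 < alpha <= 1 - 1 / Num.sqrt 2 ->
          forall (K : Type) (Tl Tr : tree K) (k : K),
            wb alpha Tl -> wb alpha Tr ->
            exists T, result (wb_join alpha Tl k Tr) = Some T /\
              Num.max (log_rank Tl) (log_rank Tr) <= log_rank T
                <= 1 + Num.max (log_rank Tl) (log_rank Tr) &
          forall (K : Type) (prio : K -> R) (Tl Tr : tree K) (k : K),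
            treap prio Tl -> treap prio Tr ->
            exists T, result (treap_join prio Tl k Tr) = Some T /\
              Num.max (log_rank Tl) (log_rank Tr) <= log_rank T
                <= 1 + Num.max (log_rank Tl) (log_rank Tr)]].
Proof.
split; first split.
- by exists 10%N => K Tl Tr k _ _; exact: avl_join_work.
- by exists 18%N => K Tl Tr k; exact: rb_join_work.
- move=> alpha /wb_range [a1 a2]; exists 37%N => K Tl Tr k.
  exact: wb_join_work.
- exists 10 => d Omega P K prio sl sr k Tl Tr t us ind unif hl hr /andP[t1 _].
  exact: treap_join_expected_work.
split.
- by move=> K Tl Tr k; exact: avl_join_rank.
- by move=> K Tl Tr k; exact: rb_join_rank.
- by move=> alpha /wb_range [a1 a2] K Tl Tr k; exact: wb_join_rank.
- by move=> K prio Tl Tr k _ _; exact: treap_join_rank.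
Qed.
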